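(* Let $n\ge 2$, let $\lambda=(\lambda_1,\dots,\lambda_n)\in\mathbb{Z}^n_{\ge 0}$ be a partition ($\lambda_1\ge\cdots\ge\lambda_n$), and let $r=|V(G_\lambda)|-1=\binom{n+2}{2}-3$. Order the vertices of $G_\lambda$ as $w_1,\dots,w_{r+1}$ as described in the context. Then $$\mathrm{Vol}\,\mathrm{GT}(\lambda)=\prod_{1\le i<j\le n}\frac{\lambda_i-\lambda_j}{j-i}=\sum_{b_1,\dots,b_{n-1}\ge 0}\frac{(\lambda_1-\lambda_2)^{b_1}}{b_1!}\cdots\frac{(\lambda_{n-1}-\lambda_n)^{b_{n-1}}}{b_{n-1}!}\,N(b_1,\dots,b_{n-1})$$ $$=\sum_{j}\frac{(\lambda_1-\lambda_2)^{j_1}}{j_1!}\cdots\frac{(\lambda_{n-1}-\lambda_n)^{j_{n-1}}}{j_{n-1}!}\,K_{G_\lambda}\big(j_1-1,\dots,j_{n-1}-1,\underbrace{-1,\dots,-1}_{\binom n2-n+1},\underbrace{0,\dots,0}_{2n-2},0\big),$$ where the last sum is over $j=(j_1,\dots,j_{n-1})\in\mathbb{Z}_{\ge0}^{n-1}$ with $j_1+\cdots+j_{n-1}=\binom n2$; and $$\big|\mathrm{GT}(\lambda)\cap\mathbb{Z}^{\binom{n+1}{2}}\big|=\prod_{1\le i<j\le n}\frac{\lambda_i-\lambda_j+j-i}{j-i}$$ $$=\sum_{j}\binom{\lambda_1-\lambda_2+1}{j_1}\cdots\binom{\lambda_{n-1}-\lambda_n+1}{j_{n-1}}\binom{1}{j_n}\cdots\binom{1}{j_{\binom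 n2}}\binom{0}{j_{\binom n2+1}}\cdots\binom{0}{j_r}\cdot K_{G_\lambda}\big(j_1-1,\dots,j_{\binom n2}-1,\,j_{\binom n2+1},\dots,j_r,\,0\big),$$ where the sum is over weak compositions $j=(j_1,\dots,j_r)\in\mathbb{Z}^r_{\ge0}$ of $\binom n2$.
   Context: The Gelfand–Tsetlin polytope $\mathrm{GT}(\lambda)\subseteq\mathbb{R}^{\binom{n+1}{2}}$ is the set of real arrays $(x_{ij})_{1\le i\le j\le n}$ with $x_{in}=\lambda_i$ for $1\le i\le n$ and $x_{i-1,j-1}\ge x_{ij}\ge x_{i-1,j}$ for all $2\le i\le j\le n$. Its volume $\mathrm{Vol}\,\mathrm{GT}(\lambda)$ means the $\binom n2$-dimensional Euclidean volume of its projection onto the coordinates $x_{ij}$ with $j<n$. The flow network $G_\lambda$ is the directed graph with vertex set $\{v_{ij}:2\le i\le j\le n\}\cup\{v_{i,i-1}:3\le i\le n+2\}\cup\{v_{i,n+1}:3\le i\le n+1\}$ and edges $(v_{ij},v_{i+1,j})$ and $(v_{ij},v_{i+1,j+1})$ for $2\le i\le j\le n$, $(v_{i,n+1},v_{i+1,n+1})$ for $3\le i\le n+1$, and $(v_{i,i-1},v_{i+1,i})$ for $3\le i\le n+1$. The vertices are ordered $w_1,\dots,w_{r+1}$ as follows: first the $v_{ij}$ with $2\le i\le j\le n$ in lexicographic order of $(i,j)$ (so $w_1,\dots,w_{n-1}$ are $v_{22},\dots,v_{2n}$), then $v_{i,i-1}$ for $3\le i\le n+1$ in increasing $i$, then $v_{i,n+1}$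 for $3\le i\le n+1$ in increasing $i$, and last $v_{n+2,n+1}$. All edges go from earlier to later vertices. For a directed acyclic multigraph $G$ with vertices ordered $w_1,\dots,w_{N}$ and $b\in\mathbb{Z}^{N}$, the Kostant partition function $K_G(b)$ is the number of ways to write $b$ as a nonnegative integer combination of the multiset of vectors $\{e_i-e_j:(w_i,w_j)\in E(G)\}$; equivalently, the number of integer flows $f\in\mathbb{Z}_{\ge0}^{E(G)}$ with $\sum_{e\text{ out of }w_i}f(e)-\sum_{e\text{ into }w_i}f(e)=b_i$ for all $i$ (it is $0$ if there are none). A shifted standard Young tableau (shSYT) of side $n$ is a bijection $T:\{(i,j):1\le i\le j\le n\}\to\{1,\dots,\binom{n+1}2\}$ with $T(i,j)<T(i+1,j)$ and $T(i,j)<T(i,j+1)$ whenever defined. $N(b_1,\dots,b_{n-1})$ denotes the number of shSYT $T$ of side $n$ with $T(i,i)=i+b_1+\cdots+b_{i-1}$ for all $1\le i\le n$.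
   Formalization: The boundary condition x_{in}=λ_i (for n=2, λ=(1,0) it makes GT(λ) empty) is corrected to x_{1j}=λ_j, with volume in the coordinates x_{ij}, i≥2; volume is expressed as the limit of normalized counts of (1/t)-grid points in the polytope. *)

(* Defs.v *)
(* All conventions.  Indices are 0-based
   internally: paper's x_{ij} (1 <= i <= j <= n) is stored at (i-1, j-1). *)
From HB Require Import structures.
From mathcomp Require Import all_boot all_order all_algebra.
Set Implicit Arguments. Unset Strict Implicit. Unset Printing Implicit Defensive.
Import Order.TTheory GRing.Theory Num.Theory.

Definition aget (n K : nat) (f : {ffun 'I_n * 'I_n -> 'I_K}) (i j : nat) : nat :=
  match (insub i : option 'I_n), (insub j : option 'I_n) with
  | Some i', Some j' => val (f (i', j'))
  | _, _ => 0%N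
  end.

Local Open Scope ring_scope.

Definition in_GT (n : nat) (lam : seq nat) (x : nat -> nat -> rat) : bool :=
  [forall j : 'I_n, x 0%N j == (nth 0%N lam j)%:R] &&
  [forall i : 'I_n, forall j : 'I_n, ((1 <= i) && (i <= j))%N ==>
     ((x i j <= x i.-1 j.-1) && (x i.-1 j <= x i j))].

(* integer points of GT(lam) (all of them have entries in [0, lam_1]) *)
Definition GT_int_points (n : nat) (lam : seq nat) :=
  [set f : {ffun 'I_n * 'I_n -> 'I_(nth 0%N lam 0).+1} |
     [forall p : 'I_n * 'I_n, (p.2 < p.1)%N ==> (val (f p) == 0%N)] &&
     in_GT n lam (fun i j => (aget f i j)%:R)].

(* points of the grid (1/t) Z^{binom n 2} lying in the projection of GT(lam)
   onto the free coordinates (paper rows i >= 2); the projection lies in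
   [0, lam_1]^{binom n 2}, so grid points are y/t with 0 <= y <= t lam_1. *)
Definition GT_grid_points (n : nat) (lam : seq nat) (t : nat) :=
  [set y : {ffun 'I_n * 'I_n -> 'I_(t * nth 0%N lam 0).+1} |
     [forall p : 'I_n * 'I_n, ~~ ((1 <= p.1) && (p.1 <= p.2))%N ==> (val (y p) == 0%N)] &&
     in_GT n lam (fun i j => if i == 0%N then (nth 0%N lam j)%:R
                             else (aget y i j)%:R / t%:R)].

(* "Vol GT(lam) = v": the (Jordan / Riemann) volume of the projection, i.e. the
   limit of (number of points of mesh-1/t grid in the body) / t^(binom n 2). *)
Definition GT_volume_is (n : nat) (lam : seq nat) (v : rat) : Prop :=
  forall eps : rat, 0 < eps -> exists T : nat, forall t : nat, (T <= t)%N -> (0 < t)%N ->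
    `| (#|GT_grid_points n lam t|)%:R / (t%:R ^+ 'C(n, 2)) - v | < eps.

Definition is_shSYT (n : nat) (T : {ffun 'I_n * 'I_n -> 'I_('C(n.+1, 2)).+1}) : bool :=
  [&& [forall p : 'I_n * 'I_n, (p.2 < p.1)%N ==> (val (T p) == 0%N)],
      [forall p : 'I_n * 'I_n, (p.1 <= p.2)%N ==> (0 < val (T p))%N],
      [forall p : 'I_n * 'I_n, forall q : 'I_n * 'I_n,
         [&& (p.1 <= p.2)%N, (q.1 <= q.2)%N & T p == T q] ==> (p == q)],
      [forall k : 'I_('C(n.+1, 2)).+1, (0 < k)%N ==>
         [exists p : 'I_n * 'I_n, (p.1 <= p.2)%N && (T p == k)]] &
      [forall i : 'I_n, forall j : 'I_n,
         ((i < j)%N ==> (aget T i j < aget T i.+1 j)%N) &&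
         (((i <= j)%N && (j.+1 < n)%N) ==> (aget T i j < aget T i j.+1)%N)]].

Definition Nsh (n : nat) (b : seq nat) : nat :=
  #|[set T : {ffun 'I_n * 'I_n -> 'I_('C(n.+1, 2)).+1} | is_shSYT T &&
       [forall i : 'I_n, aget T i i == (i.+1 + \sum_(k < i) nth 0%N b k)%N]]|.

(* The flow network G_lambda, vertices v_{ij} encoded as pairs (i,j) (paper
   indices), listed in the order w_1, ..., w_{r+1}. *)
Definition Gfree (n : nat) : seq (nat * nat) :=
  flatten [seq [seq (i, j) | j <- iota i (n.+1 - i)] | i <- iota 2 n.-1].

Definition Gverts (n : nat) : seq (nat * nat) :=
  Gfree n ++ [seq (i, i.-1) | i <- iota 3 n.-1]
          ++ [seq (i, n.+1) | i <- iota 3 n.-1] ++ [:: (n.+2, n.+1)].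

Definition Gedges (n : nat) : seq ((nat * nat) * (nat * nat)) :=
  [seq (v, (v.1.+1, v.2)) | v <- Gfree n]
  ++ [seq (v, (v.1.+1, v.2.+1)) | v <- Gfree n]
  ++ [seq ((i, n.+1), (i.+1, n.+1)) | i <- iota 3 n.-1]
  ++ [seq ((i, i.-1), (i.+1, i)) | i <- iota 3 n.-1].

Definition netflow (V : eqType) (es : seq (V * V)) (f : 'I_(size es) -> nat) (v : V) : int :=
  (\sum_(e < size es | (tnth (in_tuple es) e).1 == v) f e)%N%:Z
  - (\sum_(e < size es | (tnth (in_tuple es) e).2 == v) f e)%N%:Z.

(* Kostant partition function K_G(b) = number of nonnegative integer flows
   with net flow b_i at w_i.  (In an acyclic graph every edge carries at most
   sum_i |b_i|, so the finite range below loses no flow.) *)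
Definition kostant (V : eqType) (vs : seq V) (es : seq (V * V)) (b : seq int) : nat :=
  #|[set f : {ffun 'I_(size es) -> 'I_(\sum_(x <- b) absz x).+1} |
      (size b == size vs) &&
      [forall k : 'I_(size vs),
         @netflow V es (fun e => val (f e)) (tnth (in_tuple vs) k) == nth 0 b k]]|.

Definition KG (n : nat) (b : seq int) : nat := kostant (Gverts n) (Gedges n) b.

Definition lamd (lam : seq nat) (k : nat) : rat :=
  (nth 0%N lam k)%:R - (nth 0%N lam k.+1)%:R.

Definition vol_prod (n : nat) (lam : seq nat) : rat :=
  \prod_(i < n) \prod_(j < n | (i < j)%N)
     (((nth 0%N lam i)%:R - (nth 0%N lam j)%:R) / (j - i)%:R).

Definition latt_prod (n : nat) (lam : seq nat) : rat :=
  \prod_(i < n) \prod_(j < n | (i < j)%N)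
     (((nth 0%N lam i)%:R - (nth 0%N lam j)%:R + (j - i)%:R) / (j - i)%:R).

(* sum over b in Z_{>=0}^{n-1}; N(b) = 0 unless b_1+...+b_{n-1} = binom n 2,
   so restricting each b_k to [0, binom n 2] drops only zero terms. *)
Definition vol_N_sum (n : nat) (lam : seq nat) : rat :=
  \sum_(b : {ffun 'I_n.-1 -> 'I_('C(n, 2)).+1})
    (\prod_(k < n.-1) (lamd lam k ^+ b k / ((b k)`!)%:R)) *
    (Nsh n [seq val (b k) | k <- enum 'I_n.-1])%:R.

Definition vol_K_sum (n : nat) (lam : seq nat) : rat :=
  \sum_(j : {ffun 'I_n.-1 -> 'I_('C(n, 2)).+1} |
          (\sum_(k < n.-1) val (j k))%N == 'C(n, 2))
    (\prod_(k < n.-1) (lamd lam k ^+ j k / ((j k)`!)%:R)) *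
    (KG n ([seq (val (j k))%:Z - 1 | k <- enum 'I_n.-1]
           ++ nseq ('C(n, 2) + 1 - n) (-1) ++ nseq (2 * n - 2) 0 ++ [:: 0]))%:R.

Definition rr (n : nat) : nat := ('C(n.+2, 2) - 3)%N.

Definition latt_cap (n : nat) (lam : seq nat) (k : nat) : nat :=
  if (k < n.-1)%N then (nth 0%N lam k - nth 0%N lam k.+1).+1
  else if (k < 'C(n, 2))%N then 1%N else 0%N.

Definition latt_K_sum (n : nat) (lam : seq nat) : nat :=
  (\sum_(j : {ffun 'I_(rr n) -> 'I_('C(n, 2)).+1} |
          (\sum_(k < rr n) val (j k)) == 'C(n, 2))
    (\prod_(k < rr n) 'C(latt_cap n lam k, j k)) *
    KG n ([seq ((val (j k))%:Z - (if (k < 'C(n, 2))%N then 1 else 0))%R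
            | k <- enum 'I_(rr n)] ++ [:: 0%R]))%N.

(* Main.v *)
(** Write a_i = lambda_i - lambda_{i+1} and m = n - 1.

    Passing from one row of a Gelfand-Tsetlin pattern to the next means splitting each a_i as
    l_i + r_i; the differences of the next row are the r_i + l_{i+1}.  Expanding binomial
    coefficients of these sums by Vandermonde and using
      sum_(l + r = a) C(l,p) C(r,q) = C(a+1, p+q+1)
    turns the row recursion for lattice points into the row recursion for flows on G_lambda, which
    is the Lidskii-type formula for the number of lattice points.  The net flow 0 at the last
    vertex forces all flow through v_{i,i-1} and v_{i,n+1} to vanish, so the flows counted by the
    Kostant partition function live on the triangle of the v_{ij}, 2 <= i <= j <= n.

    Summing a determinant of binomial coefficients over interlacing rows telescopes to the
    determinant one size larger; this and Vandermonde give the product formula.  Points of the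
    mesh-1/t grid are lattice points of GT(t lambda), so the volume is the leading coefficient in t
    of both expressions for the number of lattice points, which also gives the formula with K.

    Removing the diagonal of a shifted tableau and renumbering the rest is a bijection onto
    smaller shifted tableaux whose diagonals interlace with the removed one; in terms of
    differences of diagonal entries, this is again the row recursion for flows with all inner
    demands equal to -1, so N(b) = K(b_1 - 1, ..., b_m - 1, -1, ..., -1, 0, ..., 0). *)

Require Import Defs.
From HB Require Import structures.
From mathcomp Require Import all_boot all_order all_algebra.
From mathcomp Require Import perm zify ring lra.
Set Implicit Arguments. Unset Strict Implicit. Unset Printing Implicit Defensive.
Import Order.TTheory GRing.Theory Num.Theory.

(** * Binomial sums and the row-by-row Lidskii expansion *)

Definition addseq (s t : seq nat) : seq nat := [seq p.1 + p.2 | p <- zip s t].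

Lemma sum_ord_widen (m n : nat) (F : nat -> nat) :
  m <= n -> (forall i, m <= i -> F i = 0) ->
  \sum_(i < n) F i = \sum_(i < m) F i.
Proof.
move=> lemn F0; rewrite -!(big_mkord xpredT F) (big_cat_nat (leq0n m) lemn) //=.
by rewrite [X in _ + X]big_nat_cond [X in _ + X]big1 ?addn0 // => i /andP[/andP[/F0]].
Qed.

(** Counts the subsets of size [p + q + 1] of [{0, ..., a}] by the value [l] of their [p + 1]-st
    smallest element: [p] elements lie among the [l] smaller ones, [q] among the [a - l] larger
    ones. *)
Lemma sum_bin_mul_bin (a p q : nat) :
  \sum_(l < a.+1) 'C(l, p) * 'C(a - l, q) = 'C(a.+1, (p + q).+1).
Proof.
elim: a p q => [|a IHa] p q.
  by rewrite big_ord_recl big_ord0 addn0 subnn !bin0n; case: p q => [|p] [|q].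
rewrite big_ord_recr /= subnn; case: q => [|q].
  under eq_bigr => l _ do rewrite bin0 -[1](bin0 (a - l)).
  by rewrite IHa bin0 muln1 addn0 [RHS]binS addnC.
rewrite bin0n muln0 addn0.
under eq_bigr => l _ do rewrite subSn -1?ltnS // binS mulnDr.
by rewrite big_split /= !IHa [RHS]binS addnS addnC.
Qed.

(** Weighted form of [sum_bin_mul_bin], grouped by [c = p + q + 1]. The term [c = 0] vanishes
    because its inner sum is empty; this is why a vertex of weight [c] has [c - 1] units to
    distribute. *)
Lemma sum_split_bin (a : nat) (h : nat -> nat -> nat) :
  \sum_(l < a.+1) \sum_(p < l.+1) \sum_(q < (a - l).+1)
      'C(l, p) * 'C(a - l, q) * h p q =
  \sum_(c < a.+2) 'C(a.+1, c) * \sum_(p < c) h p (c.-1 - p).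
Proof.
(* Both sides are compared with a sum over a full square; the terms added on either side have a
   vanishing binomial coefficient. *)
transitivity (\sum_(p < a.+1) \sum_(q < a.+1) 'C(a.+1, (p + q).+1) * h p q).
  under [RHS]eq_bigr => p _ do under eq_bigr => q _ do
    rewrite -sum_bin_mul_bin big_distrl /=.
  under [RHS]eq_bigr => p _ do rewrite exchange_big /=.
  rewrite exchange_big /=; apply: eq_bigr => l _.
  rewrite -(@sum_ord_widen l.+1 a.+1 (fun p => \sum_(q < (a - l).+1)
     'C(l, p) * 'C(a - l, q) * h p q)) //; last first.
    by move=> i li; rewrite big1 // => q _; rewrite bin_small.
  apply: eq_bigr => p _; rewrite -(@sum_ord_widen (a - l).+1 a.+1 (fun q =>
     'C(l, p) * 'C(a - l, q) * h p q)) //; first by lia.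
  by move=> i li; rewrite (@bin_small (a - l)) // muln0.
under [RHS]eq_bigr => c _ do rewrite big_distrr /=.
transitivity (\sum_(c < a.+2) \sum_(p < a.+1 | p < c)
   'C(a.+1, c) * h p (c.-1 - p)); last first.
  apply: eq_bigr => c _.
  by rewrite [RHS](big_ord_widen a.+1 (fun p => 'C(a.+1, c) * h p (c.-1 - p))) // -ltnS.
rewrite [RHS](exchange_big_dep xpredT) //=; apply: eq_bigr => p _.
have le1 : p.+1 <= a.+2 by case: p => p /=; lia.
rewrite -(big_mkord (fun c => p < c) (fun c => 'C(a.+1, c) * h p (c.-1 - p))).
rewrite -(big_mkord xpredT (fun q => 'C(a.+1, (p + q).+1) * h p q)).
rewrite (big_cat_nat (leq0n _) le1) //= [X in _ = X + _]big_nat_cond.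
rewrite [X in _ = X + _]big_pred0 ?add0n; last by move=> i; lia.
rewrite -[in RHS](add0n p.+1) big_addn.
have le2 : a.+2 - p.+1 <= a.+1 by lia.
rewrite (big_cat_nat (leq0n _) le2) //= [X in _ + X]big_nat_cond [X in _ + X]big1 ?addn0; last first.
  by move=> i; rewrite andbT => /andP[Hi1 Hi2]; rewrite bin_small //; lia.
rewrite big_nat [RHS]big_nat_cond; apply: eq_big => i; first by lia.
by move=> _; congr ('C(_, _) * h _ _); lia.
Qed.

(** The sums over sequences are recursions that pass a prefix to a continuation [F], so that nested
    sums compose and can be exchanged by induction on the sequence. *)
Fixpoint binsum (x : seq nat) (F : seq nat -> nat) : nat :=
  if x is a :: x' then
    \sum_(j < a.+1) 'C(a, j) * binsum x' (fun s => F (nat_of_ord j :: s))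
  else F [::].

(* [r] is what remains on the right of the previous difference: the first difference of the
   next row is [r] plus the left part [l] of [x]. *)
Fixpoint rowsum (r : nat) (a : seq nat) (F : seq nat -> nat) : nat :=
  if a is x :: a' then
    \sum_(l < x.+1) rowsum (x - l) a' (fun s => F (r + l :: s))
  else F [::].

(** The left part of the first difference and the right part of the last one do not enter any
    difference of the next row; only the choice of the splitting is summed. *)
Definition gtsum (a : seq nat) (F : seq nat -> nat) : nat :=
  if a is x :: a' then \sum_(r < x.+1) rowsum r a' F else F [::].

(* Flows out of a row of vertices whose available flow plus one is [c]; a vertex with [x] sends
   [l] to the left and [x - 1 - l] to the right, and nothing leaves the triangle on the right. *)
Fixpoint flowsum (r : nat) (c : seq nat) (F : seq nat -> nat) : nat :=
  if c is x :: c' then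
    \sum_(l < x) flowsum (x.-1 - l) c' (fun s => F (r + l :: s))
  else if r == 0 then F [::] else 0.

(* The leftmost vertex v_{ii} sends nothing to the left. *)
Definition ksum (c : seq nat) (F : seq nat -> nat) : nat :=
  if c is x :: c' then if x is x'.+1 then flowsum x' c' F else 0 else F [::].

Lemma eq_binsum x F G : (forall s, size s = size x -> F s = G s) ->
  binsum x F = binsum x G.
Proof.
elim: x F G => [|a x IHx] F G eqFG /=; first exact: eqFG.
by apply: eq_bigr => j _; congr (_ * _); apply: IHx => s ss; apply: eqFG; rewrite /= ss.
Qed.

Lemma eq_rowsum r a F G : (forall s, size s = size a -> F s = G s) ->
  rowsum r a F = rowsum r a G.
Proof.
elim: a r F G => [|x a IHa] r F G eqFG /=; first exact: eqFG.
by apply: eq_bigr => l _; apply: IHa => s ss; apply: eqFG; rewrite /= ss.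
Qed.

Lemma eq_flowsum r c F G : (forall s, size s = size c -> F s = G s) ->
  flowsum r c F = flowsum r c G.
Proof.
elim: c r F G => [|x c IHc] r F G eqFG /=; first by rewrite eqFG.
by apply: eq_bigr => l _; apply: IHc => s ss; apply: eqFG; rewrite /= ss.
Qed.

Lemma binsum_sum x (I : Type) (r : seq I) (w : I -> nat) F :
  binsum x (fun s => \sum_(i <- r) w i * F i s) = \sum_(i <- r) w i * binsum x (F i).
Proof.
elim: x F => [|a x IHx] F //=.
under eq_bigr => j _ do rewrite IHx big_distrr /=.
rewrite exchange_big /=; apply: eq_bigr => i _; rewrite big_distrr /=.
by apply: eq_bigr => j _; rewrite mulnCA.
Qed.

Lemma rowsum_sum k a (I : Type) (r : seq I) (w : I -> nat) F :
  rowsum k a (fun s => \sum_(i <- r) w i * F i s) = \sum_(i <- r) w i * rowsum k a (F i).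
Proof.
elim: a k F => [|x a IHa] k F //=.
under eq_bigr => j _ do rewrite IHa.
by rewrite exchange_big /=; apply: eq_bigr => i _; rewrite big_distrr.
Qed.

Lemma flowsum_sum k a (I : Type) (r : seq I) (w : I -> nat) F :
  flowsum k a (fun s => \sum_(i <- r) w i * F i s) = \sum_(i <- r) w i * flowsum k a (F i).
Proof.
elim: a k F => [|x a IHa] k F /=.
  by case: (k == 0) => //; rewrite big1 // => i _; rewrite muln0.
under eq_bigr => j _ do rewrite IHa.
by rewrite exchange_big /=; apply: eq_bigr => i _; rewrite big_distrr.
Qed.

Lemma binsum_cat x y F :
  binsum (x ++ y) F = binsum x (fun s => binsum y (fun t => F (s ++ t))).
Proof. by elim: x F => [|a x IHx] F //=; apply: eq_bigr => j _; rewrite IHx. Qed.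

(** Vandermonde's identity with a weight depending on the total. Pascal's rule splits the sum for
    [a + 1] into the sums for [h] and for its shift, which gives an induction on [a]. *)
Lemma sum_bin_add (a b : nat) (h : nat -> nat) :
  \sum_(j < (a + b).+1) 'C(a + b, j) * h j =
  \sum_(p < a.+1) \sum_(q < b.+1) 'C(a, p) * 'C(b, q) * h (p + q).
Proof.
elim: a h => [|a IHa] h.
  by rewrite big_ord1; apply: eq_bigr => q _; rewrite bin0 mul1n.
have pascal (N : nat) (g : nat -> nat) : \sum_(j < N.+2) 'C(N.+1, j) * g j =
    \sum_(j < N.+1) 'C(N, j) * g j + \sum_(j < N.+1) 'C(N, j) * g j.+1.
  rewrite big_ord_recl /= bin0 mul1n.
  under eq_bigr => j _ do rewrite /bump /= add1n binS mulnDl.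
  rewrite big_split /= addnA; congr (_ + _).
  by rewrite big_ord_recr /= bin_small // mul0n addn0 [RHS]big_ord_recl bin0 mul1n.
rewrite addSn (pascal (a + b) h) (IHa h) (IHa (fun x => h x.+1)).
have E g : \sum_(p < a.+2) \sum_(q < b.+1) 'C(a.+1, p) * 'C(b, q) * g (p + q) =
   \sum_(p < a.+2) 'C(a.+1, p) * (\sum_(q < b.+1) 'C(b, q) * g (p + q)).
  by apply: eq_bigr => p _; rewrite big_distrr /=; apply: eq_bigr => q _; rewrite mulnA.
rewrite (E h) (pascal a (fun p => \sum_(q < b.+1) 'C(b, q) * h (p + q))); congr (_ + _).
  by apply: eq_bigr => p _; rewrite big_distrr /=; apply: eq_bigr => q _; rewrite mulnA.
by apply: eq_bigr => p _; rewrite big_distrr /=; apply: eq_bigr => q _; rewrite mulnA.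
Qed.

(** The exchange at the heart of the Lidskii expansion. An entry of the next row plus one is
    [1 + r + l], so Vandermonde chooses separately from the constant 1, from [r] and from [l]; the
    choices from the two parts of one difference [x] then merge into one choice from [x + 1]. The
    constant 1 survives as the capacity of an inner vertex. *)
Lemma rowsum_binsum r a g :
  rowsum r a (fun s => binsum (map S s) g) =
  \sum_(p < r.+1) 'C(r, p) * binsum (map S a) (fun c => flowsum p c
     (fun s => binsum (nseq (size s) 1) (fun e => g (addseq e s)))).
Proof.
elim: a r g => [|a0 a IHa] r g /=.
  rewrite big_ord_recl /= big1 ?addn0 ?bin0 ?mul1n //.
  by move=> i _; rewrite muln0.
pose H (x : nat) s := binsum (map S s) (fun t => g (x :: t)).
pose K (x q : nat) := binsum (map S a) (fun c => flowsum q c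
  (fun s => binsum (nseq (size s) 1) (fun e => g (x :: addseq e s)))).
have IHK (k x : nat) : rowsum k a (H x) = \sum_(q < k.+1) 'C(k, q) * K x q.
  by rewrite /H IHa.
pose K' (x q : nat) := \sum_(e < 2) 'C(1, e) * K (e + x) q.
(* Vandermonde splits the choice from [1 + (r + l)] into [e], [i] and [p], and [q] is the choice
   from the right part [a0 - l]; this is the shape that [sum_split_bin] requires. *)
transitivity (\sum_(l < a0.+1) \sum_(p < l.+1) \sum_(q < (a0 - l).+1)
   'C(l, p) * 'C(a0 - l, q) * \sum_(i < r.+1) 'C(r, i) * K' (i + p) q).
  apply: eq_bigr => l _.
  transitivity (rowsum (a0 - l) a (fun s => \sum_(e < 2) 'C(1, e) *
     \sum_(i < r.+1) 'C(r, i) * \sum_(p < l.+1) 'C(l, p) * H (e + (i + p)) s)).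
    apply: eq_rowsum => s _ /=.
    have -> : (r + l).+1 = 1 + (r + l) by [].
    rewrite (@sum_bin_add 1 (r + l) (fun j => H j s)).
    apply: eq_bigr => e _. under [LHS]eq_bigr => p _ do rewrite -mulnA.
    rewrite -big_distrr /=; congr (_ * _).
    rewrite (@sum_bin_add r l (fun j => H (e + j) s)).
    apply: eq_bigr => i _; rewrite big_distrr /=.
    by apply: eq_bigr => p _; rewrite mulnA.
  rewrite rowsum_sum.
  under eq_bigr => e _ do rewrite rowsum_sum.
  under eq_bigr => e _ do under eq_bigr => i _ do rewrite rowsum_sum.
  under eq_bigr => e _ do under eq_bigr => i _ do under eq_bigr => p _ do rewrite IHK.
  under eq_bigr => e _ do rewrite big_distrr /=.
  under eq_bigr => e _ do under eq_bigr => i _ do rewrite !big_distrr /=.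
  under eq_bigr => e _ do under eq_bigr => i _ do under eq_bigr => p _ do rewrite !big_distrr /=.
  under [RHS]eq_bigr => p _ do under eq_bigr => q _ do rewrite big_distrr /=.
  under [RHS]eq_bigr => p _ do under eq_bigr => q _ do under eq_bigr => i _ do rewrite /K' !big_distrr /=.
  under eq_bigr => e _ do rewrite exchange_big /=.
  rewrite exchange_big /=; apply: eq_bigr => p _.
  under eq_bigr => e _ do rewrite exchange_big /=.
  rewrite exchange_big /=; apply: eq_bigr => q _.
  rewrite exchange_big /=; apply: eq_bigr => i _; apply: eq_bigr => e _.
  by nia.
rewrite (@sum_split_bin a0 (fun p q => \sum_(i < r.+1) 'C(r, i) * K' (i + p) q)).
under [RHS]eq_bigr => i _ do rewrite big_distrr /=.
rewrite [RHS]exchange_big /=; apply: eq_bigr => c _.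
under [RHS]eq_bigr => i _ do rewrite mulnCA.
rewrite -big_distrr /=; congr (_ * _).
rewrite exchange_big /=; apply: eq_bigr => i _; rewrite -big_distrr /=; congr (_ * _).
(* The choice [e] from the constant 1 moves inside the flow sum and becomes the first entry of the
   added sequence. *)
transitivity (binsum (map S a) (fun s => \sum_(l < c) 1 * flowsum (c.-1 - l) s
   (fun s0 => binsum (nseq (size (i + l :: s0)) 1) (fun e => g (addseq e (i + l :: s0)))))).
  rewrite binsum_sum; apply: eq_bigr => p _; rewrite mul1n /K' /K.
  transitivity (binsum (map S a) (fun s => \sum_(e < 2) 'C(1, e) *
     flowsum (c.-1 - p) s (fun t => binsum (nseq (size t) 1)
       (fun u => g (e + (i + p) :: addseq u t))))); first by rewrite binsum_sum.
  apply: eq_binsum => s _.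
  transitivity (flowsum (c.-1 - p) s (fun t => \sum_(e < 2) 'C(1, e) *
     binsum (nseq (size t) 1) (fun u => g (e + (i + p) :: addseq u t)))).
    by rewrite flowsum_sum.
  by apply: eq_flowsum.
by apply: eq_binsum => s _; apply: eq_bigr => l _; rewrite mul1n.
Qed.

Fixpoint gtcount (m : nat) (a : seq nat) : nat :=
  if m is m'.+1 then gtsum a (gtcount m') else 1.

(* [c] is the first row of vertex weights, [e] the concatenation of the remaining rows, of
   lengths m - 1, ..., 1; a vertex of weight [j] has net flow [j - 1]. *)
Fixpoint flowcount (m : nat) (c e : seq nat) : nat :=
  if m is m'.+1 then
    ksum c (fun s => flowcount m' (addseq (take m' e) s) (drop m' e))
  else 1.

Lemma binsum_flowsum x k c (F : seq nat -> seq nat -> nat) :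
  binsum x (fun e => flowsum k c (F e)) = flowsum k c (fun s => binsum x (F^~ s)).
Proof.
elim: x F => [|a x IHx] F //=.
by rewrite flowsum_sum; apply: eq_bigr => j _; rewrite IHx.
Qed.

Lemma binsum0 x : binsum x (fun=> 0) = 0.
Proof. by elim: x => [|a x IHx] //=; rewrite big1 // => j _; rewrite IHx muln0. Qed.

(** Iterating [rowsum_binsum] down the triangle leaves capacity [a_i + 1] at each vertex of the
    first row and capacity 1 at each of the ['C(m, 2)] vertices below. *)
Lemma gtcount_binsum m a : size a = m ->
  gtcount m a = binsum (map S a) (fun c => binsum (nseq 'C(m, 2) 1) (flowcount m c)).
Proof.
elim: m a => [|m IHm] [|x a] //= [sa].
pose g c := binsum (nseq 'C(m, 2) 1) (flowcount m c).
pose Z k := binsum (map S a) (fun c => flowsum k c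
   (fun s => binsum (nseq (size s) 1) (fun e => g (addseq e s)))).
(* The range of [k] is extended to one independent of [r], by terms with ['C(r, k) = 0], so that the
   sums can be exchanged. *)
transitivity (\sum_(r < x.+1) \sum_(k < x.+1) 'C(r, k) * Z k).
  apply: eq_bigr => r _.
  rewrite (@eq_rowsum _ _ _ (fun s => binsum (map S s) g)); last first.
    by move=> s ss; apply: IHm; rewrite ss.
  rewrite rowsum_binsum (@sum_ord_widen r.+1 x.+1 (fun k => 'C(r, k) * Z k)) //.
  by move=> i ri; rewrite bin_small.
(* Summing ['C(r, k)] over [r] gives ['C(x.+1, k.+1)], so the leftmost vertex has weight [k + 1] and
   sends [k] to the right; its weight 0 contributes nothing. *)
rewrite exchange_big /= [RHS]big_ord_recl /= [X in _ = _ * X + _](_ : _ = 0); last first.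
  rewrite -[RHS](binsum0 (map S a)); apply: eq_binsum => s _; exact: binsum0.
rewrite muln0 add0n; apply: eq_bigr => k _; rewrite -big_distrl /=; congr (_ * _).
  have := sum_bin_mul_bin x k 0; rewrite addn0 => <-.
  by apply: eq_bigr => l _; rewrite bin0 muln1.
apply: eq_binsum => c; rewrite size_map => sc.
rewrite /= binsum_flowsum; apply: eq_flowsum => s ss.
rewrite binS bin1 addnC nseqD binsum_cat ss sc sa.
apply: eq_binsum => e se; apply: eq_binsum => t _.
rewrite size_nseq in se.
by rewrite take_size_cat // drop_size_cat.
Qed.

Lemma sumn_addseq s t : size s = size t -> sumn (addseq s t) = sumn s + sumn t.
Proof. by elim: s t => [|x s IHs] [|y t] //= [/IHs]; rewrite /addseq /= => ->; lia. Qed.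

Lemma size_addseq s t : size s = size t -> size (addseq s t) = size t.
Proof. by move=> st; rewrite size_map size_zip st minnn. Qed.

Lemma flowsum_neq0 k c F : flowsum k c F != 0 ->
  exists s, [/\ size s = size c, F s != 0 & sumn s + size c = k + sumn c].
Proof.
elim: c k F => [|x c IHc] k F /=.
  by case: (eqVneq k 0) => [->|] // F0; exists [::].
rewrite sum_nat_eq0 => /forallPn[l] /=; case/IHc=> s [ss Fs sums].
exists (k + l :: s); split=> //=; first by rewrite ss.
by case: l sums Fs => l ltlx /= sums _; lia.
Qed.

(** Conservation: each vertex absorbs one unit of weight and nothing leaves the triangle, so the
    total weight is the number of vertices. This makes the constraints on the totals of the
    summation indices automatic and isolates the leading terms in the limit. *)
Lemma flowcount_neq0 m c e : size c = m -> size e = 'C(m, 2) ->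
  flowcount m c e != 0 -> sumn c + sumn e = 'C(m.+1, 2).
Proof.
elim: m c e => [|m IHm] [|x c] e //=; first by move=> _ /size0nil ->.
move=> [sc] se; case: x => [|x] //= /flowsum_neq0[s [ss]].
have st : size (take m e) = size s.
  by rewrite ss size_take se sc binS bin1; case: ltnP; lia.
move/IHm; rewrite size_addseq // ss sc size_drop se [X in X - m]binS bin1 addnK.
move=> /(_ erefl erefl); rewrite sumn_addseq // [in RHS]binS bin1.
have := congr1 sumn (cat_take_drop m e); rewrite sumn_cat => h1 h2 h3.
by rewrite binS bin1 (binS m 1) bin1; lia.
Qed.

(** * Counting integer points by interlacing rows *)

(** Common frame for the bijections below: a finite set defined by conditions is matched with a
    duplicate-free enumeration. *)
Lemma card_image_seq (T : finType) (U : eqType) (A : {set T}) (h : T -> U) (s : seq U) :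
  {in A &, injective h} -> uniq s -> (forall x, x \in A -> h x \in s) ->
  (forall y, y \in s -> exists2 x, x \in A & h x = y) -> #|A| = size s.
Proof.
move=> h_inj us hs sh; rewrite cardE -(size_map h).
apply/perm_size/uniq_perm => //.
  by rewrite map_inj_in_uniq ?enum_uniq // => x y; rewrite !mem_enum; apply: h_inj.
move=> y; apply/mapP/idP => [[x]|/sh[x xA <-]].
  by rewrite mem_enum => /hs hx ->.
by exists x; rewrite ?mem_enum.
Qed.

Fixpoint interlacing (x : seq nat) : seq (seq nat) :=
  if x is y1 :: t then
    if t is y2 :: _ then [seq z :: u | z <- iota y2 (y1.+1 - y2), u <- interlacing t]
    else [:: [::]]
  else [:: [::]].

Lemma mem_interlacing x u : reflect
  (size u = (size x).-1 /\ forall i, i < size u -> nth 0 x i.+1 <= nth 0 u i <= nth 0 x i)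
  (u \in interlacing x).
Proof.
elim: x u => [|y1 [|y2 x] IHx] u.
- rewrite inE; apply: (iffP eqP) => [->|[/size0nil]] //.
- rewrite inE; apply: (iffP eqP) => [->|[/size0nil]] //.
apply: (iffP allpairsP) => [[[z v] /= [zi /IHx[sv Hv] ->]]|[]].
  split=> /=; first by rewrite sv.
  by case=> [_|i /= iv]; [rewrite mem_iota in zi; rewrite /=; lia | apply: Hv].
case: u => [|z u] //= [su] Hu; exists (z, u); split=> //=.
  by rewrite mem_iota; have := Hu 0 isT; rewrite /=; lia.
by apply/IHx; split=> // i iu; apply: (Hu i.+1).
Qed.

Lemma interlacing_uniq x : uniq (interlacing x).
Proof.
elim: x => [|y1 [|y2 x] IHx] //; apply: allpairs_uniq; rewrite ?iota_uniq //.
by move=> [a b] [c d] _ _ /= [-> ->].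
Qed.

Fixpoint gtchains (k : nat) (x : seq nat) : seq (seq (seq nat)) :=
  if k is k'.+1 then [seq u :: c | u <- interlacing x, c <- gtchains k' u] else [:: [::]].

Fixpoint gtpatterns (k : nat) (x : seq nat) : nat :=
  if k is k'.+1 then \sum_(u <- interlacing x) gtpatterns k' u else 1.

Lemma size_gtchains k x : size (gtchains k x) = gtpatterns k x.
Proof.
elim: k x => [|k IHk] x //=; rewrite size_allpairs_dep sumnE big_map.
by apply: eq_bigr => u _.
Qed.

Lemma gtchains_uniq k x : uniq (gtchains k x).
Proof.
elim: k x => [|k IHk] x //=; apply: allpairs_uniq_dep => //; first exact: interlacing_uniq.
by move=> [a b] [c d] _ _ /= [-> ->].
Qed.

Lemma mem_gtchains k x c :
  (c \in gtchains k x) = (size c == k) && path (fun s u => u \in interlacing s) x c.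
Proof.
elim: k x c => [|k IHk] x c /=; first by rewrite inE; case: c.
apply/allpairsPdep/idP => [[u [d [ux dk ->]]]|].
  by move: dk; rewrite IHk /= eqSS ux => /andP[-> ->].
case: c => [|u d] //= /and3P[sd ux pd]; exists u, d; split=> //.
by rewrite IHk -eqSS sd.
Qed.

Definition gt_entry n K (lam : seq nat) (f : {ffun 'I_n * 'I_n -> 'I_K}) (i j : nat) :=
  if i == 0 then nth 0 lam j else aget f i j.

Lemma aget_ord n K (f : {ffun 'I_n * 'I_n -> 'I_K}) (i j : 'I_n) :
  aget f i j = f (i, j).
Proof. by rewrite /aget !valK. Qed.

Lemma aget_small n K (f : {ffun 'I_n * 'I_n -> 'I_K}) (i j : nat)
  (lin : i < n) (ljn : j < n) : aget f i j = f (Ordinal lin, Ordinal ljn).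
Proof. by rewrite -aget_ord. Qed.

(** The filler [u] prescribes the entries outside the free triangle. It lets one count serve both
    for integer points, which store the top row, and for grid points, which store zeros there. *)
Definition gt_fillings n K lam (u : 'I_n * 'I_n -> 'I_K) :=
  [set f : {ffun 'I_n * 'I_n -> 'I_K} |
     [forall p : 'I_n * 'I_n, ~~ ((1 <= p.1) && (p.1 <= p.2)) ==> (f p == u p)] &&
     [forall i : 'I_n, forall j : 'I_n, (1 <= i) && (i <= j) ==>
       ((gt_entry lam f i j <= gt_entry lam f i.-1 j.-1) &&
        (gt_entry lam f i.-1 j <= gt_entry lam f i j))]].

Lemma card_gt_fillings n K lam (u : 'I_n * 'I_n -> 'I_K.+1) :
  0 < n -> size lam = n -> all (fun x => x <= K) lam ->
  #|gt_fillings lam u| = gtpatterns n.-1 lam.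
Proof.
move=> n0 slam lamK; rewrite -size_gtchains.
pose row (f : {ffun 'I_n * 'I_n -> 'I_K.+1}) i := [seq gt_entry lam f i j | j <- iota i (n - i)].
have row0 f : row f 0 = lam.
  rewrite /row subn0 /gt_entry /= -[RHS](mkseq_nth 0) slam /mkseq. by [].
pose rows f := [seq row f i | i <- iota 1 n.-1].
have srow f i : size (row f i) = n - i by rewrite size_map size_iota.
have nrow f i p : p < n - i -> nth 0 (row f i) p = gt_entry lam f i (i + p).
  by move=> pi; rewrite (nth_map 0) ?size_iota // nth_iota.
have nrows f i : i < n -> nth [::] (lam :: rows f) i = row f i.
  case: i => [|i] lin /=; first by rewrite row0.
  by rewrite (nth_map 0) ?size_iota ?nth_iota //; lia.
apply: (@card_image_seq _ _ _ rows); last 1 first.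
- move=> c; rewrite mem_gtchains => /andP[/eqP sc /(pathP [::])]; rewrite sc => pc.
  (* Interlacing carries the bound [K] from each row to the next, so that [inord] below does not
     alter any entry. *)
  have rc i : i < n -> size (nth [::] (lam :: c) i) = n - i /\
      all (fun x => x <= K) (nth [::] (lam :: c) i).
    elim: i => [|i IHi] lin; first by rewrite /= subn0.
    have [|si aK] := IHi; first by lia.
    have /mem_interlacing[sn Hn] : nth [::] (lam :: c) i.+1 \in
      interlacing (nth [::] (lam :: c) i) by apply: pc; lia.
    rewrite sn si; split; first by lia.
    apply/(all_nthP 0) => p /[dup] ps /Hn /andP[_ h]; apply: leq_trans h _.
    by apply: (all_nthP 0 aK); lia.
  pose f := [ffun p : 'I_n * 'I_n => if (1 <= p.1) && (p.1 <= p.2) then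
      inord (nth 0 (nth [::] (lam :: c) p.1) (p.2 - p.1)) else u p].
  have fE i j : i <= j -> j < n -> gt_entry lam f i j =
      nth 0 (nth [::] (lam :: c) i) (j - i).
    move=> ij jn; rewrite /gt_entry; case: (posnP i) => [->|i0]; first by rewrite subn0.
    have lin : i < n by lia.
    have [si aK] := rc _ lin.
    rewrite (aget_small f lin jn) ffunE /= ij i0 /= inordK // ltnS.
    by apply: (all_nthP 0 aK); lia.
  have rowE i : i < n -> row f i = nth [::] (lam :: c) i.
    move=> lin; have [si aK] := rc _ lin.
    apply: (@eq_from_nth _ 0); rewrite srow ?si // => p pn.
    by rewrite nrow // fE ?addKn //; lia.
  exists f; last first.
    apply: (@eq_from_nth _ [::]); rewrite size_map size_iota ?sc // => i ni.
    by have := nrows f i.+1; rewrite /= => -> //; rewrite ?rowE //; lia.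
  rewrite inE; apply/andP; split; apply/forallP => i.
    by apply/implyP => /negPf hi; rewrite ffunE hi.
  apply/forallP => j; apply/implyP => /andP[i0 ij].
  have := ltn_ord i; have := ltn_ord j => jn lin.
  rewrite !fE //; try lia.
  have /mem_interlacing[sn Hn] : nth [::] (lam :: c) i.-1.+1 \in
    interlacing (nth [::] (lam :: c) i.-1) by apply: pc; lia.
  rewrite prednK // in sn Hn.
  have [si aK] := rc _ lin.
  have /Hn : j - i < size (nth [::] (lam :: c) i) by lia.
  have -> : (j - i).+1 = j - i.-1 by lia.
  have -> : j.-1 - i.-1 = j - i by lia.
  by rewrite andbC.
- move=> f g; rewrite !inE => /andP[/forallP f1 _] /andP[/forallP g1 _] eqr.
  apply/ffunP => p; case: (boolP ((1 <= p.1) && (p.1 <= p.2))) => [/andP[p0 p12]|np]; last first.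
    by have /eqP -> := implyP (f1 p) np; have /eqP -> := implyP (g1 p) np.
  have : row f p.1 = row g p.1 by rewrite -!nrows // eqr.
  move/(congr1 (nth 0 ^~ (p.2 - p.1))).
  have := ltn_ord p.2 => l2.
  rewrite !nrow; try lia.
  rewrite subnKC // /gt_entry; have -> : (nat_of_ord p.1 == 0) = false by lia.
  by rewrite !aget_ord -surjective_pairing => /val_inj.
- exact: gtchains_uniq.
move=> f; rewrite inE mem_gtchains => /andP[_ /forallP f2].
rewrite size_map size_iota eqxx /=; apply/(pathP [::]) => i.
rewrite size_map size_iota => li.
have lin : i.+1 < n by lia.
have -> : nth [::] (rows f) i = nth [::] (lam :: rows f) i.+1 by [].
rewrite !nrows //; last by lia.
apply/mem_interlacing; rewrite !srow; split=> [|p pn]; first by lia.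
have ljn : i.+1 + p < n by lia.
rewrite !nrow //; try lia.
have /forallP/(_ (Ordinal ljn))/implyP := f2 (Ordinal lin).
by rewrite /= addnS andbC => H; have := H; rewrite andbC => -> //; lia.
Qed.

(** * From rows to their successive differences *)

Fixpoint diffs (x : seq nat) : seq nat :=
  if x is y1 :: t then if t is y2 :: _ then y1 - y2 :: diffs t else [::] else [::].

Lemma size_diffs x : size (diffs x) = (size x).-1.
Proof. by elim: x => [|y1 [|y2 x] IHx] //=; rewrite IHx. Qed.

Lemma nth_diffs x i : i.+1 < size x -> nth 0 (diffs x) i = nth 0 x i - nth 0 x i.+1.
Proof.
elim: x i => [|y1 [|y2 x] IHx] //= [|i] // ix.
exact: IHx.
Qed.

Lemma sum_iota_add (y k : nat) (F : nat -> nat) :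
  \sum_(z <- iota y k) F z = \sum_(r < k) F (y + r).
Proof.
by rewrite -[y in iota y]addn0 iotaDl big_map -[k in iota _ k]subn0 -/(index_iota 0 k) big_mkord.
Qed.

Lemma interlacing_sorted x u : u \in interlacing x -> sorted geq x -> sorted geq u.
Proof.
move=> /mem_interlacing[su Hu] sx; apply/(sortedP 0) => i iu.
have /andP[_ h1] := Hu _ iu.
have /andP[h2 _] := Hu i (ltnW iu).
exact: leq_trans h1 h2.
Qed.

Lemma rowsum_interlacing y x z (F : seq nat -> nat) :
  sorted geq (y :: x) -> y <= z ->
  rowsum (z - y) (diffs (y :: x)) F =
  \sum_(u <- interlacing (y :: x)) F (diffs (z :: u)).
Proof.
elim: x y z F => [|y2 x IHx] y z F sx yz; first by rewrite big_seq1.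
have /andP[y2y sx'] := sx : (y2 <= y) && sorted geq (y2 :: x).
rewrite big_allpairs_dep /= (_ : y.+1 - y2 = (y - y2).+1); last by lia.
rewrite (sum_iota_add y2 _ (fun w => \sum_(u <- _) F (diffs (z :: w :: u)))).
(* The left part decreases as the interlacing entry increases, hence the reversal of the index. *)
rewrite (reindex_inj rev_ord_inj) /=; apply: eq_bigr => l _.
have lb := ltn_ord l.
have yl : y2 <= y2 + l by lia.
have := IHx y2 (y2 + l) (fun s => F (z - (y2 + l) :: s)) sx' yl.
rewrite addKn /= => <-.
have -> : y - y2 - ((y - y2).+1 - l.+1) = l by lia.
by have -> : z - y + ((y - y2).+1 - l.+1) = z - (y2 + l) by lia.
Qed.

Lemma gtcount_diffs m x : size x = m.+1 -> sorted geq x ->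
  gtcount m (diffs x) = gtpatterns m x.
Proof.
elim: m x => [|m IHm] [|y [|y2 x]] //= [sx] /[dup] sy /andP[y2y sy2].
rewrite [RHS]big_allpairs_dep /= (_ : y.+1 - y2 = (y - y2).+1); last by lia.
rewrite (sum_iota_add y2 _ (fun w => \sum_(u <- _) gtpatterns m (w :: u))).
apply: eq_bigr => r _.
have yr : y2 <= y2 + r by lia.
have := @rowsum_interlacing y2 x (y2 + r) (gtcount m) sy2 yr.
rewrite addKn => ->; rewrite big_seq [RHS]big_seq; apply: eq_bigr => u ux.
have H : y2 + r :: u \in interlacing [:: y, y2 & x].
  by apply/allpairsP; exists (y2 + r, u); rewrite mem_iota; split=> //=; case: r {yr} => r /=; lia.
apply: IHm; last exact: interlacing_sorted H sy.
by case/mem_interlacing: ux => su _; rewrite /= su /= sx.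
Qed.

Lemma sorted_geq_nth x i j : sorted geq x -> i <= j -> j < size x -> nth 0 x j <= nth 0 x i.
Proof.
move=> sx ij jx.
have geq_tr : transitive geq by move=> a b c /= ab ac; apply: leq_trans ac ab.
have geq_re : reflexive geq by move=> a /=.
by apply: (sorted_leq_nth geq_tr geq_re 0 sx) => //; rewrite inE; lia.
Qed.

Lemma sorted_geq_all x : sorted geq x -> all (fun y => y <= nth 0 x 0) x.
Proof. by move=> sx; apply/(all_nthP 0) => i ix; apply: sorted_geq_nth. Qed.

Lemma card_GT_int_points n lam : 2 <= n -> size lam = n -> sorted geq lam ->
  #|GT_int_points n lam| = gtpatterns n.-1 lam.
Proof.
move=> n2 slam sl.
have lamK := sorted_geq_all sl.
(* The filler holds [lam] in the top row and zeros below the diagonal, as the encoding of integer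
   points demands. *)
pose u (p : 'I_n * 'I_n) : 'I_(nth 0 lam 0).+1 :=
  if p.1 == 0 :> nat then inord (nth 0 lam p.2) else ord0.
rewrite -(@card_gt_fillings n _ lam u) //; last by lia.
apply: eq_card => f; rewrite !inE.
have n0 : 0 < n by lia.
have uE (j : 'I_n) : val (u (Ordinal n0, j)) = nth 0 lam j.
  by rewrite /u /= inordK // ltnS; apply: (all_nthP 0 lamK); rewrite slam.
have fE (i j : nat) : (forall j : 'I_n, aget f 0 j = nth 0 lam j) ->
    j < n -> gt_entry lam f i j = aget f i j.
  move=> f0 jn; rewrite /gt_entry; case: eqP => [->|//].
  by rewrite (f0 (Ordinal jn)).
apply/andP/andP => [[/forallP f1 /andP[/forallP f2 /forallP f3]]|[/forallP f1 /forallP f2]].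
  have f0 : forall j : 'I_n, aget f 0 j = nth 0 lam j.
    by move=> j; have := f2 j; rewrite eqr_nat => /eqP.
  split; apply/forallP => i.
    case: i => i j; apply/implyP => /= hi; apply/eqP/val_inj; case: (posnP i) => i0.
      rewrite (_ : i = Ordinal n0) ?uE; last exact/val_inj.
      by rewrite -f0; apply: (esym (aget_ord f (Ordinal n0) j)).
    have -> : u (i, j) = ord0 by rewrite /u /= (negPf (lt0n_neq0 i0)).
    by have /implyP/= hf := f1 (i, j); apply/eqP/hf; lia.
  apply/forallP => j; apply/implyP => ij; rewrite !fE //; last first.
    by apply: leq_ltn_trans (leq_pred _) _.
  by have /forallP/(_ j)/implyP/(_ ij) := f3 i; rewrite !ler_nat.
have f0 : forall j : 'I_n, aget f 0 j = nth 0 lam j.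
  move=> j; rewrite (aget_small f n0 (ltn_ord j)).
  have -> : Ordinal (ltn_ord j) = j by exact/val_inj.
  have /implyP/(_ isT)/eqP -> := f1 (Ordinal n0, j).
  exact: uE.
split.
  apply/forallP => -[i j]; apply/implyP => /= ji.
  have /implyP/= := f1 (i, j); rewrite negb_and -!ltnNge ji orbT => /(_ isT)/eqP ->.
  by rewrite /u /= (_ : (i == 0 :> nat) = false) //; lia.
apply/andP; split; first by apply/forallP => j; rewrite f0.
apply/forallP => i; apply/forallP => j; apply/implyP => ij.
have /forallP/(_ j)/implyP/(_ ij) := f2 i.
rewrite !ler_nat !fE //.
by apply: leq_ltn_trans (leq_pred _) _.
Qed.

(** Multiplying all inequalities by [t] turns grid points of the polytope of [lam] into integer
    points of the polytope of [t lam]. *)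
Lemma card_GT_grid_points n lam t : 2 <= n -> size lam = n -> sorted geq lam -> 0 < t ->
  #|GT_grid_points n lam t| = gtpatterns n.-1 (map (muln t) lam).
Proof.
move=> n2 slam sl t0.
have lamK := sorted_geq_all sl.
rewrite -(@card_gt_fillings n (t * nth 0 lam 0) (map (muln t) lam) (fun=> ord0));
  [|by lia|by rewrite size_map|]; last first.
  by rewrite all_map; apply: sub_all lamK => y /= ?; rewrite leq_mul2l; lia.
apply: eq_card => f; rewrite !inE; congr (_ && _).
rewrite /in_GT /=.
have -> : [forall j : 'I_n, ((nth 0 lam j)%:R == (nth 0 lam j)%:R :> rat)%R] = true.
  by apply/forallP => j.
rewrite /=; apply: eq_forallb => i; apply: eq_forallb => j; congr (_ ==> _).
pose x i j : rat := (if i == 0 then (nth 0 lam j)%:R else (aget f i j)%:R / t%:R)%R.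
have xE (k l : nat) : l < n -> (x k l = (gt_entry (map (muln t) lam) f k l)%:R / t%:R)%R.
  move=> ln; rewrite /x /gt_entry; case: eqP => // _.
  rewrite (nth_map 0) ?slam // natrM mulrAC mulfV ?mul1r //.
  by rewrite pnatr_eq0; lia.
rewrite -!/(x _ _) !xE //; last by apply: leq_ltn_trans (leq_pred _) _.
have tp : (0 < (t%:R)^-1 :> rat)%R by rewrite invr_gt0 ltr0n.
by rewrite !(ler_pM2r tp) !ler_nat.
Qed.

(** * The product formula *)

Section ProductFormula.
Local Open Scope ring_scope.

(** The entries of a row interlacing with a fixed [x] range over intervals independently of each
    other, so the sum of products factors. *)
Lemma sum_interlacing_prod (R : comNzRingType) m (x : seq nat) (G : nat -> nat -> R) :
  size x = m.+1 ->
  \sum_(u <- interlacing x) \prod_(i < m) G i (nth 0%N u i) =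
  \prod_(i < m) \sum_(z <- iota (nth 0%N x i.+1) ((nth 0%N x i).+1 - nth 0%N x i.+1)) G i z.
Proof.
elim: m x G => [|m IHm] [|y1 [|y2 x]] G //= => [_|[sx]].
  by rewrite big_seq1 !big_ord0.
rewrite big_allpairs_dep big_ord_recl /= big_distrl /=; apply: eq_bigr => z _.
have := IHm (y2 :: x) (fun i => G i.+1); rewrite /= => <-; last by rewrite sx.
rewrite big_distrr /=; apply: eq_bigr => u _.
by rewrite big_ord_recl.
Qed.

Lemma det_col_one (R : comNzRingType) m (A : 'M[R]_m.+1) :
  (forall i, A i ord0 = 1) ->
  \det A = \det (\matrix_(i < m, j < m)
     (A (lift ord0 i) (lift ord0 j) - A (widen_ord (leqnSn m) i) (lift ord0 j))).
Proof.
move=> A1.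
(* Multiplication by this unitriangular matrix subtracts from each row the preceding one; the first
   column becomes the first unit vector and the determinant is expanded along it. *)
pose L : 'M[R]_m.+1 := \matrix_(i, j) ((i == j)%:R - (i == j.+1 :> nat)%:R).
have detL : \det L = 1.
  rewrite det_trig; last first.
    apply/is_trig_mxP => i j ij; rewrite mxE.
    have -> : (i == j) = false by apply/eqP => E; rewrite E ltnn in ij.
    by rewrite (_ : (_ == j.+1) = false) ?subrr //; lia.
  rewrite big1 // => i _; rewrite mxE eqxx (_ : (_ == i.+1) = false) ?subr0 //; lia.
have B0 j : (L *m A) ord0 j = A ord0 j.
  rewrite mxE (bigD1 ord0) //= mxE eqxx subr0 mul1r big1 ?addr0 // => k k0.
  by rewrite mxE eq_sym (negPf k0) subr0 mul0r.
have BS (i : 'I_m) j : (L *m A) (lift ord0 i) j =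
    A (lift ord0 i) j - A (widen_ord (leqnSn m) i) j.
  rewrite mxE (bigD1 (lift ord0 i)) //= (bigD1 (widen_ord (leqnSn m) i)) /=; last first.
    by rewrite -val_eqE /= /bump /=; lia.
  rewrite !mxE eqxx /= /bump /= !add1n eqxx.
  rewrite (_ : (_ == _.+2) = false) ?subr0 ?mul1r; last by lia.
  rewrite -val_eqE /= /bump /= add1n (_ : (_ == _) = false) ?sub0r ?mulN1r; last by lia.
  rewrite big1 ?addr0 // => k /andP[k1 k2]; rewrite mxE /= /bump /= add1n eqSS.
  rewrite eq_sym (negPf k1) (_ : (_ == _) = false) ?subrr ?mul0r //.
  by apply/negbTE; rewrite -val_eqE /= eq_sym in k2.
rewrite -[LHS]mul1r -detL -det_mulmx (expand_det_col _ ord0) big_ord_recl big1 ?addr0.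
  rewrite B0 A1 mul1r /cofactor addn0 expr0 mul1r; congr (\det _).
  by apply/matrixP => i j; rewrite !mxE -BS mxE.
by move=> i _; rewrite BS !A1 subrr mul0r.
Qed.

(* The sign makes [det (signed_bin j (x i))] positive for decreasing [x]. *)
Definition signed_bin (j x : nat) : rat := (-1) ^+ j * ('C(x, j))%:R.

(** Pascal's rule makes the sum telescope; the alternating sign reverses the order of the two
    boundary terms. *)
Lemma sum_signed_bin (j a k : nat) :
  \sum_(z <- iota a k) signed_bin j z = signed_bin j.+1 a - signed_bin j.+1 (a + k).
Proof.
elim: k a => [|k IHk] a /=; first by rewrite big_nil addn0 subrr.
rewrite big_cons IHk addSnnS /signed_bin binS natrD exprS.
by ring.
Qed.

Definition rising (R : comNzRingType) (j : nat) : {poly R} := \prod_(k < j) ('X + (k%:R)%:P).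

Lemma rising_monic (R : comNzRingType) j : rising R j \is monic.
Proof. by apply: monic_prod => k _; apply: monicXaddC. Qed.

Lemma size_rising (R : idomainType) j : size (rising R j) = j.+1.
Proof.
elim: j => [|j IHj]; first by rewrite /rising big_ord0 size_poly1.
rewrite /rising big_ord_recr /= size_Mmonic ?monicXaddC ?monic_neq0 ?rising_monic //.
by rewrite IHj size_XaddC addn2.
Qed.

(** The sign turns each factor [x - k] into [- x + k]. For [x < j] the falling factorial is zero,
    which takes care of the truncated subtraction. *)
Lemma signed_bin_rising j x : signed_bin j x = (rising rat j).[- x%:R] / (j`!)%:R.
Proof.
have f0 : (j`!)%:R != 0 :> rat by rewrite pnatr_eq0 -lt0n fact_gt0.
apply: (canRL (mulfK f0)).
rewrite /signed_bin -mulrA -natrM bin_ffact.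
elim: j {f0} => [|j IHj]; first by rewrite /rising big_ord0 hornerC ffactn0 mul1r.
rewrite /rising big_ord_recr /= hornerM -/(rising rat j) -IHj.
rewrite hornerD hornerX hornerC ffactnSr natrM exprS.
case: (leqP j x) => jx; first by rewrite natrB //; ring.
by rewrite ffact_small // !(mul0r, mulr0).
Qed.

Lemma prod_sub_fact (R : comNzRingType) n :
  \prod_(i < n) \prod_(j < n | (i < j)%N) ((j - i)%:R : R) = \prod_(j < n) (j`!)%:R.
Proof.
rewrite (exchange_big_dep xpredT) //=; apply: eq_bigr => j _.
rewrite -(big_ord_widen n (fun i => (j - i)%:R)); last exact: ltnW.
rewrite fact_prod natr_prod big_add1 /= big_mkord (reindex_inj rev_ord_inj) /=.
by apply: eq_bigr => i _; rewrite subKn.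
Qed.

(** Up to the factors [1 / j!], the columns evaluate monic polynomials of degree [j] at [- x i].
    Passing to monomials is unitriangular, so the determinant is a Vandermonde determinant divided
    by the product of the [j!], which is also the product of all [j - i]. *)
Lemma det_signed_bin n (x : nat -> nat) :
  \det (\matrix_(i < n, j < n) signed_bin j (x i)) =
  \prod_(i < n) \prod_(j < n | (i < j)%N) (((x i)%:R - (x j)%:R) / (j - i)%:R).
Proof.
pose a : 'rV[rat]_n := \row_i (- (x i)%:R).
pose T : 'M[rat]_n := \matrix_(j, k) (rising rat j)`_k.
pose d : 'rV[rat]_n := \row_j ((j`!)%:R)^-1.
have -> : \matrix_(i < n, j < n) signed_bin j (x i) =
    (T *m Vandermonde n a)^T *m diag_mx d.
  apply/matrixP => i j; rewrite mul_mx_diag !mxE signed_bin_rising; congr (_ / _).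
  rewrite (@horner_coef_wide _ n) ?size_rising //.
  by apply: eq_bigr => k _; rewrite !mxE.
rewrite det_mulmx det_diag det_tr det_mulmx det_Vandermonde det_trig; last first.
  apply/is_trig_mxP => i j ij; rewrite mxE nth_default // size_rising //.
rewrite big1 ?mul1r; last first.
  move=> i _; rewrite mxE; have /monicP := rising_monic rat i.
  by rewrite lead_coefE size_rising.
transitivity ((\prod_(i < n) \prod_(j < n | (i < j)%N) ((x i)%:R - (x j)%:R)) /
  \prod_(j < n) ((j`!)%:R : rat)); last first.
  by rewrite -prod_sub_fact -prodf_div; apply: eq_bigr => i _; rewrite -prodf_div.
congr (_ * _).
  by apply: eq_bigr => i _; apply: eq_bigr => j _; rewrite !mxE opprK addrC.
by rewrite -prodfV; apply: eq_bigr => j _; rewrite mxE.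
Qed.

(** By induction on the number of rows: summing over the interlacing rows telescopes each matrix
    entry into a difference of consecutive rows of the larger matrix, whose first column is
    constantly 1. The shift [m - i] aligns the ends of the intervals with those rows. *)
Lemma gtpatterns_det m x : size x = m.+1 -> sorted geq x ->
  (gtpatterns m x)%:R =
  \det (\matrix_(i < m.+1, j < m.+1) signed_bin j (nth 0%N x i + (m - i))%N).
Proof.
elim: m x => [|m IHm] x sx sorx.
  by rewrite det_mx11 mxE /signed_bin expr0 bin0 mul1r.
have sle i : (i < m.+1)%N -> (nth 0%N x i.+1 <= nth 0%N x i)%N.
  by move=> im; apply: (sortedP 0%N sorx); rewrite sx.
rewrite /= natr_sum det_col_one; last first.
  by move=> i; rewrite mxE /signed_bin expr0 bin0 mul1r.
transitivity (\det (\matrix_(i < m.+1, j < m.+1)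
   \sum_(z <- iota (nth 0%N x i.+1) ((nth 0%N x i).+1 - nth 0%N x i.+1))
      signed_bin j (z + (m - i))%N)).
  rewrite big_seq; under eq_bigr => u ux.
    have [su _] := mem_interlacing _ _ ux.
    rewrite IHm; [|by rewrite su sx|exact: interlacing_sorted ux sorx].
    over.
  (* Multilinearity in the rows is used through the Leibniz expansion: in each term the entries of
     the interlacing row separate. *)
  rewrite -big_seq /determinant exchange_big /=; apply: eq_bigr => s _.
  rewrite -big_distrr /=; congr (_ * _).
  pose G (i z : nat) := signed_bin (s (inord i)) (z + (m - i))%N.
  transitivity (\sum_(u <- interlacing x) \prod_(i < m.+1) G i (nth 0%N u i)).
    by apply: eq_bigr => u _; apply: eq_bigr => i _; rewrite /G inord_val mxE.
  rewrite (sum_interlacing_prod G sx); apply: eq_bigr => i _; rewrite mxE.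
  by apply: eq_bigr => z _; rewrite /G inord_val.
congr (\det _); apply/matrixP => i j; rewrite !mxE /= /bump /= !add1n subSS.
have li := sle _ (ltn_ord i).
(* The shifted interval ends just before [nth 0 x i + (m.+1 - i)], the argument in row [i] of the
   larger matrix. *)
transitivity (\sum_(z <- iota (nth 0%N x i.+1 + (m - i)) ((nth 0%N x i).+1 - nth 0%N x i.+1))
  signed_bin j z).
  by rewrite addnC iotaDl big_map; apply: eq_bigr => z _; rewrite addnC.
rewrite sum_signed_bin; congr (_ - signed_bin _ _).
by have := ltn_ord i; lia.
Qed.

Lemma gtpatterns_latt_prod n lam : (0 < n)%N -> size lam = n -> sorted geq lam ->
  (gtpatterns n.-1 lam)%:R = latt_prod n lam.
Proof.
case: n => // n _ sl sorl; rewrite gtpatterns_det // (det_signed_bin n.+1 (fun i => nth 0 lam i + (n - i))%N).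
apply: eq_bigr => i _; apply: eq_bigr => j ij; congr (_ / _).
have jn : (j <= n)%N by rewrite -ltnS.
have -> : (n - i = n - j + (j - i))%N by lia.
by rewrite !natrD; ring.
Qed.

End ProductFormula.

(** * The Kostant partition function of the flow network *)

Local Notation nthp := (nth (0, 0)).

(* A row of flows is the list of the pairs (flow to the left, flow to the right). *)
Fixpoint tail_splits (k : nat) (c : seq nat) : seq (seq (nat * nat)) :=
  if c is x :: c' then
    [seq (l, x.-1 - l) :: u | l <- iota 0 x, u <- tail_splits (x.-1 - l) c']
  else if k == 0 then [:: [::]] else [::].

Definition splits (c : seq nat) : seq (seq (nat * nat)) :=
  if c is x :: c' then
    if x is x'.+1 then [seq (0, x') :: u | u <- tail_splits x' c'] else [::]
  else [:: [::]].

(** A vertex of the next row receives the right flow of one vertex and the left flow of its right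
    neighbour. The outermost two flows do not appear; [splits] forces them to be 0. *)
Definition outflow (w : seq (nat * nat)) : seq nat :=
  [seq q.1.2 + q.2.1 | q <- zip w (behead w)].

Lemma size_outflow w : size (outflow w) = (size w).-1.
Proof. by rewrite size_map size_zip size_behead; lia. Qed.

Lemma nth_outflow w p : p.+1 < size w ->
  nth 0 (outflow w) p = (nthp w p).2 + (nthp w p.+1).1.
Proof.
move=> pw; rewrite (nth_map ((0, 0), (0, 0))); last by rewrite size_zip size_behead; lia.
by rewrite nth_zip_cond size_zip size_behead (_ : p < _) ?nth_behead //; lia.
Qed.

(** The component [a] is arbitrary, since [outflow] does not read the left flow of the first
    pair. *)
Lemma flowsum_splits k a c F :
  flowsum k c F = \sum_(u <- tail_splits k c) F (outflow ((a, k) :: u)).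
Proof.
elim: c k a F => [|x c IHc] k a F /=.
  by case: eqP => _; rewrite ?big_nil // big_seq1.
rewrite big_allpairs_dep /= (sum_iota_add 0 x (fun l => \sum_(u <- _) F (outflow _))).
by apply: eq_bigr => l _; rewrite (IHc _ (nat_of_ord l)).
Qed.

Lemma ksum_splits c F : ksum c F = \sum_(w <- splits c) F (outflow w).
Proof.
case: c => [|[|x] c] /=; first by rewrite big_seq1.
  by rewrite big_nil.
by rewrite big_map (flowsum_splits x 0).
Qed.

Lemma mem_tail_splits k c u : reflect
  [/\ size u = size c, forall p, p < size c -> ((nthp u p).1 + (nthp u p).2).+1 = nth 0 c p &
      (last (0, k) u).2 = 0]
  (u \in tail_splits k c).
Proof.
elim: c k u => [|x c IHc] k u /=.
  case: (eqVneq k 0) => k0.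
    by rewrite inE; apply: (iffP eqP) => [->|[/size0nil]].
  by rewrite in_nil; constructor; case=> /size0nil -> _ /= /eqP; rewrite (negPf k0).
apply: (iffP allpairsPdep) => [[l [v [lx /IHc[sv Hv lv] ->]]]|[]].
  rewrite mem_iota in lx; split=> /=; first by rewrite sv.
    by case=> [_|p pc] /=; [lia | apply: Hv].
  by case: v lv {sv Hv}.
case: u => [|[l r] v] // [sv] Hv lv; exists l, v; have /= := Hv 0 isT => Elr.
have -> : x.-1 - l = r by lia.
split=> //; first by rewrite mem_iota; lia.
apply/IHc; split=> // [p pc|]; first exact: (Hv p.+1).
by move: lv => /=; case: (v).
Qed.

Lemma mem_splits c w : 0 < size c -> reflect
  [/\ size w = size c, forall p, p < size c -> ((nthp w p).1 + (nthp w p).2).+1 = nth 0 c p,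
      (nthp w 0).1 = 0 & (nthp w (size c).-1).2 = 0]
  (w \in splits c).
Proof.
case: c => [|[|x] c] // _ /=.
  by constructor; case=> _ /(_ 0 isT).
apply: (iffP mapP) => [[u /mem_tail_splits[su Hu lu] ->]|[]].
  split=> //=; first by rewrite su.
    by case=> [|p] //=; apply: Hu.
  by rewrite -su -(last_nth (0, 0) (0, x) u).
case: w => [|[l r] w] // [sw] Hw /= l0 lw; exists w; last first.
  by have := Hw 0 isT; rewrite /= l0 add0n => -[->].
have /= := Hw 0 isT; rewrite l0 => -[r0].
apply/mem_tail_splits; split=> // [p pc|]; first exact: (Hw p.+1).
by move: lw; rewrite -sw -(last_nth (0, 0) (l, r) w); case: (w) => //= <-.
Qed.

Lemma tail_splits_uniq k c : uniq (tail_splits k c).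
Proof.
elim: c k => [|x c IHc] k /=; first by case: eqP.
apply: allpairs_uniq_dep; rewrite ?iota_uniq //.
by move=> [a b] [c' d] _ _ /= [-> _ ->].
Qed.

Lemma splits_uniq c : uniq (splits c).
Proof.
case: c => [|[|x] c] //=; rewrite map_inj_uniq ?tail_splits_uniq //.
by move=> u v [].
Qed.

Fixpoint flowchains (m : nat) (c e : seq nat) : seq (seq (seq (nat * nat))) :=
  if m is m'.+1 then
    [seq w :: d | w <- splits c,
                  d <- flowchains m' (addseq (take m' e) (outflow w)) (drop m' e)]
  else [:: [::]].

Lemma size_flowchains m c e : size (flowchains m c e) = flowcount m c e.
Proof.
elim: m c e => [|m IHm] c e //=; rewrite size_allpairs_dep sumnE big_map ksum_splits.
by apply: eq_bigr => u _.
Qed.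

Lemma flowchains_uniq m c e : uniq (flowchains m c e).
Proof.
elim: m c e => [|m IHm] c e //=; apply: allpairs_uniq_dep => //; first exact: splits_uniq.
by move=> [a b] [c' d] _ _ /= [-> ->].
Qed.

Fixpoint triangle (m : nat) (c e : seq nat) : seq (seq nat) :=
  if m is m'.+1 then c :: triangle m' (take m' e) (drop m' e) else [::].

Lemma flatten_triangle m c e : size c = m -> size e = 'C(m, 2) ->
  flatten (triangle m c e) = c ++ e.
Proof.
elim: m c e => [|m IHm] c e /=; first by move=> /size0nil -> /size0nil ->.
rewrite binS bin1 => sc se; rewrite IHm ?cat_take_drop // ?size_takel ?size_drop; lia.
Qed.

Lemma shape_triangle m c e : size c = m -> size e = 'C(m, 2) ->
  shape (triangle m c e) = [seq m - i | i <- iota 0 m].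
Proof.
elim: m c e => [|m IHm] c e //=.
rewrite binS bin1 => sc se; rewrite sc IHm ?size_takel ?size_drop //; try lia.
by rewrite subn0 -[1]addn0 iotaDl -map_comp; congr cons; apply: eq_map => i; rewrite /= add1n.
Qed.

Definition cell m c e i p : nat := nth 0 (nth [::] (triangle m c e) i) p.

Definition dcell (d : seq (seq (nat * nat))) i p := nthp (nth [::] d i) p.

Definition inflow (d : seq (seq (nat * nat))) i p : nat :=
  if i is i'.+1 then (dcell d i' p).2 + (dcell d i' p.+1).1 else 0.

Lemma nth_addseq s t p : size s = size t -> nth 0 (addseq s t) p = nth 0 s p + nth 0 t p.
Proof.
move=> st; case: (ltnP p (size s)) => ps; last first.
  have pt : size t <= p by rewrite -st.
  by rewrite (nth_default 0 ps) (nth_default 0 pt) nth_default // size_addseq.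
rewrite (nth_map (0, 0)) ?nth_zip // size_zip; lia.
Qed.

(** Replaces the recursion by rows with the local conservation law at each cell, in the form in
    which a flow on the graph satisfies it; the successor reflects that a cell of weight [x] has net
    flow [x - 1]. *)
Lemma mem_flowchains m c e d : size c = m -> size e = 'C(m, 2) -> reflect
  (size d = m /\ forall i, i < m ->
    [/\ size (nth [::] d i) = m - i, (dcell d i 0).1 = 0, (dcell d i (m - i.+1)).2 = 0 &
      forall p, p < m - i ->
        ((dcell d i p).1 + (dcell d i p).2).+1 = cell m c e i p + inflow d i p])
  (d \in flowchains m c e).
Proof.
elim: m c e d => [|m IHm] c e d sc se.
  by rewrite inE; apply: (iffP eqP) => [->|[/size0nil]].
have c0 : 0 < size c by rewrite sc.
have ste : size (take m e) = m by rewrite size_takel // se binS bin1; lia.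
have sde : size (drop m e) = 'C(m, 2) by rewrite size_drop se binS bin1; lia.
have saw w : size w = m.+1 -> size (addseq (take m e) (outflow w)) = m.
  by move=> sw; rewrite size_addseq size_outflow ?sw ?ste.
have cellE w i p : size w = m.+1 -> i < m ->
    cell m (addseq (take m e) (outflow w)) (drop m e) i p =
    cell m.+1 c e i.+1 p + (if i == 0 then nth 0 (outflow w) p else 0).
  move=> sw im; rewrite /cell /=; case: m ste {IHm sc se sde saw} im sw => [|m] ste // im sw /=.
  case: i im => [|i] im /=; last by rewrite addn0.
  by rewrite nth_addseq // size_outflow sw ste.
apply: (iffP allpairsPdep) => [[w [d' [ws]]]|[]].
  case/(mem_splits _ c0): ws; rewrite sc => sw Hw w0 wl.
  case/IHm => // [|sd' Hd' ->]; first exact: saw.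
  split=> /=; first by rewrite sd'.
  case=> [|i] im.
    rewrite /dcell /= subn0 subSS subn0; split=> // p pm.
    by rewrite addn0; apply: Hw.
  have [s1 l0 r0 Hp] := Hd' i im; rewrite !subSS; split=> // p pm.
  rewrite -[LHS]/(((dcell d' i p).1 + (dcell d' i p).2).+1) Hp // cellE // -addnA; congr (_ + _).
  case: i im {s1 l0 r0 Hp} pm => [|i] im pm /=; last by rewrite add0n.
  by rewrite addn0 nth_outflow // sw; lia.
case: d => [|w d'] // [sd'] Hd; exists w, d'.
have [sw w0 wl Hw] := Hd 0 isT; rewrite /= !subSS !subn0 in sw w0 wl Hw.
split=> //.
  apply/(mem_splits _ c0); rewrite sc; split=> // p pm.
  by have := Hw p pm; rewrite addn0.
apply/IHm => //; first exact: saw.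
split=> // i im; have [s1 l0 r0 Hp] := Hd i.+1 im; rewrite !subSS in s1 l0 r0 Hp.
split=> // p pm.
rewrite -[LHS]/(((dcell (w :: d') i.+1 p).1 + (dcell (w :: d') i.+1 p).2).+1) Hp // cellE //.
rewrite -addnA; congr (_ + _).
case: i im {s1 l0 r0 Hp} pm => [|i] im pm /=; last by rewrite add0n.
by rewrite addn0 nth_outflow // sw; lia.
Qed.

Definition excess (x : nat) : nat := absz (x%:Z - 1)%R.

(** The Kostant partition function admits edge values only up to the sum of the absolute demands, so
    this bound is needed to realise every chain as a flow. What a row sends on is at most the total
    excess of that row, and receiving [s] raises an excess by at most [s]. *)
Lemma flowchains_bound m c e d i p : size c = m -> size e = 'C(m, 2) ->
  d \in flowchains m c e ->
  (dcell d i p).1 + (dcell d i p).2 <= \sum_(x <- c ++ e) excess x.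
Proof.
elim: m c e d i p => [|m IHm] c e d i p sc se.
  by rewrite inE => /eqP ->; rewrite /dcell !nth_nil.
have c0 : 0 < size c by rewrite sc.
have ste : size (take m e) = m by rewrite size_takel // se binS bin1; lia.
have sde : size (drop m e) = 'C(m, 2) by rewrite size_drop se binS bin1; lia.
case/allpairsPdep => w [d' [/(mem_splits _ c0) [sw Hw w0 wl] Hd' ->]].
have sow : size (outflow w) = m by rewrite size_outflow sw sc.
have sumw : \sum_(p < m.+1) ((nthp w p).1 + (nthp w p).2) <= \sum_(x <- c) excess x.
  rewrite (big_nth 0) big_mkord sc; apply: leq_sum => q _.
  by rewrite -Hw ?sc // /excess; lia.
rewrite big_cat /=; case: i => [|i].
  apply: leq_trans (leq_addr _ _); case: (ltnP p m.+1) => pm; last first.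
    by rewrite /dcell /= nth_default // sw sc.
  by apply: leq_trans sumw; rewrite (bigD1 (Ordinal pm)) //=; exact: leq_addr.
have := IHm _ _ _ i p _ sde Hd'.
rewrite size_addseq ?sow ?ste // => /(_ erefl) h; apply: leq_trans h _.
rewrite big_cat /= -[in X in _ <= _ + X](cat_take_drop m e) big_cat /= addnA leq_add2r.
apply: (@leq_trans (\sum_(q < m) (nth 0 (outflow w) q + excess (nth 0 (take m e) q)))).
  rewrite (big_nth 0) big_mkord size_addseq ?sow ?ste //; apply: leq_sum => q _.
  by rewrite nth_addseq ?sow ?ste // /excess; lia.
rewrite big_split /=; apply: leq_add; last first.
  by rewrite [X in _ <= X](big_nth 0) big_mkord ste.
apply: leq_trans sumw.
apply: (@leq_trans (\sum_(q < m) ((nthp w q).2 + (nthp w q.+1).1))).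
  by apply: leq_sum => q _; rewrite nth_outflow // sw sc ltnS.
rewrite !big_split /= addnC; apply: leq_add.
  by rewrite [X in _ <= X]big_ord_recl leq_addl.
by rewrite [X in _ <= X]big_ord_recr leq_addr.
Qed.

(** * Edges and net flows of the graph *)

Lemma mem_Gfree n i j : ((i, j) \in Gfree n) = [&& 2 <= i, i <= j & j <= n].
Proof.
apply/allpairsPdep/idP => [[a [b [ai bi [-> ->]]]]|/and3P[i2 ij jn]].
  by rewrite !mem_iota in ai bi; lia.
by exists i, j; rewrite !mem_iota; split=> //; lia.
Qed.

Lemma Gfree_uniq n : uniq (Gfree n).
Proof.
apply: allpairs_uniq_dep => [|i _|]; rewrite ?iota_uniq //.
by move=> [a b] [c d] _ _ /= [-> ->].
Qed.

Lemma Gedges_uniq n : uniq (Gedges n).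
Proof.
rewrite /Gedges !cat_uniq !map_inj_uniq ?Gfree_uniq ?iota_uniq //; first last.
- by move=> u v [].
- by move=> u v [].
- by move=> u v [].
- by move=> u v [].
rewrite /= andbT; apply/and3P; split.
- apply/hasPn => x; rewrite !mem_cat => /or3P[] /mapP[].
  + move=> v vG ->; apply/mapP => -[w _ [-> _]].
    by lia.
  + move=> i; rewrite mem_iota => im ->; apply/mapP => -[[a b]].
    by rewrite mem_Gfree => ab [] *; lia.
  + move=> i; rewrite mem_iota => im ->; apply/mapP => -[[a b]].
    by rewrite mem_Gfree => ab [] *; lia.
- apply/hasPn => x; rewrite !mem_cat => /orP[] /mapP[].
  + move=> i; rewrite mem_iota => im ->; apply/mapP => -[[a b]].
    by rewrite mem_Gfree => ab [] *; lia.
  + move=> i; rewrite mem_iota => im ->; apply/mapP => -[[a b]].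
    by rewrite mem_Gfree => ab [] *; lia.
- apply/hasPn => x /mapP[i]; rewrite mem_iota => im ->; apply/mapP => -[j].
  by rewrite mem_iota => jm [] *; lia.
Qed.

(** Each of the four families of edges has at most one edge with a given end; [x] is its index and
    [b] records whether the shape of the family permits that end. *)
Lemma big_seq_pick (I J : eqType) (s : seq I) (h : I -> J) (y : J) (x : I) (F : I -> nat) (b : bool) :
  uniq s -> {in s, forall w, (h w == y) = b && (w == x)} ->
  \sum_(w <- s | h w == y) F w = if b && (x \in s) then F x else 0.
Proof.
move=> us hs; rewrite big_seq_cond.
case: b hs => hs /=; last first.
  by rewrite big_pred0 // => w; apply/andP => -[ws]; rewrite hs.
case: ifP => xs; last first.
  rewrite big_pred0 // => w; apply/andP => -[ws]; rewrite hs //= => /eqP wx.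
  by rewrite -wx ws in xs.
rewrite (eq_bigl (fun w => w == x)); first by rewrite -big_filter filter_pred1_uniq // big_seq1.
move=> w.
case: (boolP (w \in s)) => ws; first by rewrite hs.
by apply/esym/negP => /eqP wx; rewrite wx xs in ws.
Qed.

Section EdgeSums.
Variables (n : nat) (g : (nat * nat) * (nat * nat) -> nat).
(** The edges along the side [v_{i,n+1}] have the shape [L], those along the side [v_{i,i-1}] the
    shape [R]. *)
Let L a b := g ((a, b), (a.+1, b)).
Let R a b := g ((a, b), (a.+1, b.+1)).

Lemma sum_out a b :
  \sum_(x <- Gedges n | x.1 == (a, b)) g x =
  (if [&& 2 <= a, a <= b & b <= n] then L a b else 0) +
  ((if [&& 2 <= a, a <= b & b <= n] then R a b else 0) +
  ((if (b == n.+1) && (3 <= a <= n.+1) then L a b else 0) +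
  (if (a == b.+1) && (3 <= a <= n.+1) then R a b else 0))).
Proof.
rewrite /Gedges !big_cat !big_map /=; congr (_ + (_ + (_ + _))).
- rewrite (@big_seq_pick _ _ _ id (a, b) (a, b) (fun v => g (v, (v.1.+1, v.2))) true) //.
  + by rewrite mem_Gfree.
  + exact: Gfree_uniq.
- rewrite (@big_seq_pick _ _ _ id (a, b) (a, b) (fun v => g (v, (v.1.+1, v.2.+1))) true) //.
  + by rewrite mem_Gfree.
  + exact: Gfree_uniq.
- rewrite (@big_seq_pick _ _ _ (fun i => (i, n.+1)) (a, b) a
    (fun i => g ((i, n.+1), (i.+1, n.+1))) (b == n.+1)) ?iota_uniq //.
  + rewrite mem_iota (_ : 3 + n.-1 = maxn 3 n.+2); last by lia.
    case: eqP => [->|//] /=.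
    by rewrite (_ : (3 <= a < _) = (3 <= a <= n.+1)) //; lia.
  + by move=> i _; rewrite xpair_eqE andbC eq_sym.
- rewrite (@big_seq_pick _ _ _ (fun i => (i, i.-1)) (a, b) a
    (fun i => g ((i, i.-1), (i.+1, i))) (a == b.+1)) ?iota_uniq //.
  + rewrite mem_iota (_ : (a == b.+1) && (3 <= a < 3 + n.-1) = (a == b.+1) && (3 <= a <= n.+1)); last by lia.
    by case: eqP => [->|//].
  + by move=> i; rewrite mem_iota xpair_eqE; lia.
Qed.

Lemma sum_in a b :
  \sum_(x <- Gedges n | x.2 == (a.+1, b.+1)) g x =
  (if [&& 2 <= a, a <= b.+1 & b < n] then L a b.+1 else 0) +
  ((if [&& 2 <= a, a <= b & b <= n] then R a b else 0) +
  ((if (b == n) && (3 <= a <= n.+1) then L a b.+1 else 0) +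
  (if (a == b.+1) && (3 <= a <= n.+1) then R a b else 0))).
Proof.
rewrite /Gedges !big_cat !big_map /=; congr (_ + (_ + (_ + _))).
- rewrite (@big_seq_pick _ _ _ (fun v => (v.1.+1, v.2)) (a.+1, b.+1) (a, b.+1)
    (fun v => g (v, (v.1.+1, v.2))) true) //.
  + by rewrite mem_Gfree.
  + exact: Gfree_uniq.
- rewrite (@big_seq_pick _ _ _ (fun v => (v.1.+1, v.2.+1)) (a.+1, b.+1) (a, b)
    (fun v => g (v, (v.1.+1, v.2.+1))) true) //.
  + by rewrite mem_Gfree.
  + exact: Gfree_uniq.
- rewrite (@big_seq_pick _ _ _ (fun i => (i.+1, n.+1)) (a.+1, b.+1) a
    (fun i => g ((i, n.+1), (i.+1, n.+1))) (b == n)) ?iota_uniq //.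
  + rewrite mem_iota (_ : (b == n) && (3 <= a < 3 + n.-1) = (b == n) && (3 <= a <= n.+1)); last by lia.
    by case: eqP => [->|//].
  + by move=> i _; rewrite xpair_eqE !eqSS andbC eq_sym.
- rewrite (@big_seq_pick _ _ _ (fun i => (i.+1, i)) (a.+1, b.+1) a
    (fun i => g ((i, i.-1), (i.+1, i))) (a == b.+1)) ?iota_uniq //.
  + rewrite mem_iota (_ : (a == b.+1) && (3 <= a < 3 + n.-1) = (a == b.+1) && (3 <= a <= n.+1)); last by lia.
    by case: eqP => [->|//].
  + by move=> i; rewrite mem_iota xpair_eqE; lia.
Qed.

End EdgeSums.

Definition net (n : nat) (g : (nat * nat) * (nat * nat) -> nat) (v : nat * nat) : int :=
  ((\sum_(x <- Gedges n | x.1 == v) g x)%:Z - (\sum_(x <- Gedges n | x.2 == v) g x)%:Z)%R.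

(** Reads a flow indexed by positions as a function of the edges themselves, which is faithful when
    no edge is repeated. *)
Definition edge_fun (V : eqType) (es : seq (V * V)) (f : 'I_(size es) -> nat) (x : V * V) : nat :=
  if insub (index x es) is Some k then f k else 0.

Lemma edge_fun_tnth (V : eqType) (es : seq (V * V)) (f : 'I_(size es) -> nat) k :
  uniq es -> edge_fun f (tnth (in_tuple es) k) = f k.
Proof.
move=> ues; rewrite /edge_fun (tnth_nth (tnth (in_tuple es) k)) /= index_uniq //.
by rewrite valK.
Qed.

Lemma netflow_net n (f : 'I_(size (Gedges n)) -> nat) v :
  netflow f v = net n (edge_fun f) v.
Proof.
rewrite /netflow /net; congr (_%:Z - _%:Z)%R; rewrite [RHS]big_tnth;
  by apply: eq_bigr => k _; rewrite edge_fun_tnth // Gedges_uniq.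
Qed.

Definition sink_verts n : seq (nat * nat) :=
  [seq (i, i.-1) | i <- iota 3 n.-1] ++ [seq (i, n.+1) | i <- iota 3 n.-1] ++ [:: (n.+2, n.+1)].

(* The sink has net flow 0, so nothing enters it; going backwards, no flow reaches the side
   vertices v_{i,i-1} and v_{i,n+1}. *)
Lemma net_sink_verts0 n g : 2 <= n -> {in sink_verts n, forall v, net n g v = 0%R} ->
  (forall a, 3 <= a <= n.+1 -> g ((a, n.+1), (a.+1, n.+1)) = 0 /\ g ((a, a.-1), (a.+1, a)) = 0) /\
  (forall a, 2 <= a <= n -> g ((a, n), (a.+1, n.+1)) = 0 /\ g ((a, a), (a.+1, a)) = 0).
Proof.
move=> n2 Hg.
have HR a : 3 <= a <= n.+1 -> net n g (a, n.+1) = 0%R.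
  by move=> ha; apply: Hg; rewrite !mem_cat map_f ?orbT // mem_iota; lia.
have HL a : 3 <= a <= n.+1 -> net n g (a, a.-1) = 0%R.
  by move=> ha; apply: Hg; rewrite !mem_cat map_f // mem_iota; lia.
have HS : net n g (n.+2, n.+1) = 0%R by apply: Hg; rewrite !mem_cat inE eqxx !orbT.
pose P a := g ((a, n.+1), (a.+1, n.+1)) = 0 /\ g ((a, a.-1), (a.+1, a)) = 0.
have PS : P n.+1.
  move: HS; rewrite /net sum_out sum_in /P /=.
  do 6 (rewrite ifF; last by lia).
  do 2 (rewrite ifT; last by lia).
  by lia.
have stepR a : 2 <= a <= n -> g ((a.+1, n.+1), (a.+2, n.+1)) = 0 ->
    g ((a, n), (a.+1, n.+1)) = 0 /\ (3 <= a -> g ((a, n.+1), (a.+1, n.+1)) = 0).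
  move=> ha H0; have ha' : 3 <= a.+1 <= n.+1 by lia.
  have := HR _ ha'; rewrite /net sum_out sum_in H0.
  rewrite ifF; last by lia.
  rewrite ifF; last by lia.
  rewrite if_same ifF; last by lia.
  rewrite ifF; last by lia.
  rewrite ifT; last by lia.
  rewrite [if (a == n.+1) && _ then _ else _]ifF; last by lia.
  by case: ifP => ha3; lia.
have stepL a : 2 <= a <= n -> g ((a.+1, a), (a.+2, a.+1)) = 0 ->
    g ((a, a), (a.+1, a)) = 0 /\ (3 <= a -> g ((a, a.-1), (a.+1, a)) = 0).
  case: a => // a ha H0; have ha' : 3 <= a.+2 <= n.+1 by lia.
  have := HL _ ha'; rewrite /net /= sum_out sum_in H0.
  rewrite ifF; last by lia.
  rewrite ifF; last by lia.
  rewrite ifF; last by lia.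
  rewrite if_same ifT; last by lia.
  rewrite ifF; last by lia.
  rewrite ifF; last by lia.
  by case: ifP => ha3; lia.
have HP d a : a + d = n.+1 -> 3 <= a -> P a.
  elim: d a => [|d IHd] a ad a3; first by have -> : a = n.+1 by lia.
  have [h1 h2] : P a.+1 by apply: IHd; lia.
  have ha : 2 <= a <= n by lia.
  by split; [apply: (stepR a ha h1).2 | apply: (stepL a ha h2).2].
split=> a ha; first by apply: (HP (n.+1 - a)); lia.
have [h1 h2] : P a.+1 by apply: (HP (n - a)); lia.
by split; [apply: (stepR a ha h1).1 | apply: (stepL a ha h2).1].
Qed.

(** Row [i], position [p] of the triangle is the vertex [v_{i+2,i+2+p}]. Positions count from the
    diagonal, so a left edge leads to position [p - 1] and a right edge to position [p] of the next
    row. *)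
Definition left_edge (g : (nat * nat) * (nat * nat) -> nat) i p :=
  g ((i.+2, i.+2 + p), (i.+3, i.+2 + p)).

Definition right_edge (g : (nat * nat) * (nat * nat) -> nat) i p :=
  g ((i.+2, i.+2 + p), (i.+3, (i.+2 + p).+1)).

Lemma net_free n g i p : 2 <= n -> i < n.-1 -> p < n.-1 - i ->
  net n g (i.+2, i.+2 + p) =
  ((left_edge g i p + right_edge g i p)%N%:Z
  - (if i is i'.+1 then right_edge g i' p + left_edge g i' p.+1 else 0)%N%:Z)%R.
Proof.
move=> n2 im pm; rewrite /net sum_out [in X in (_ - X)%R]addSn sum_in.
rewrite ifT; last by lia.
rewrite ifT; last by lia.
rewrite ifF; last by lia.
rewrite ifF; last by lia.
rewrite !addn0; congr (_%:Z - _%:Z)%R.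
case: i im pm => [|i] im pm /=.
  by rewrite !ifF; lia.
rewrite ifT; last by lia.
rewrite ifT; last by lia.
rewrite ifF; last by lia.
rewrite ifF; last by lia.
by rewrite !addn0 [LHS]addnC /left_edge addnS.
Qed.

Definition demand (x : nat) : int := (x%:Z - 1)%R.

Lemma map_Gfree (T : Type) n (F : nat * nat -> T) :
  [seq F v | v <- Gfree n] =
  flatten [seq [seq F (i.+2, i.+2 + p) | p <- iota 0 (n.-1 - i)] | i <- iota 0 n.-1].
Proof.
rewrite /Gfree map_flatten -map_comp.
rewrite (_ : iota 2 n.-1 = [seq 2 + i | i <- iota 0 n.-1]); last by rewrite -iotaDl.
rewrite -map_comp; congr flatten; apply: eq_map => i /=; rewrite -map_comp add2n.
rewrite (_ : iota i.+2 (n.+1 - i.+2) = [seq i.+2 + p | p <- iota 0 (n.-1 - i)]).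
  by rewrite -map_comp.
by rewrite -iotaDl addn0; congr iota; lia.
Qed.

(** Both lists are flattenings of triangles of the same shape, so they agree exactly when all cells
    agree. *)
Lemma nets_eq n c e (F : nat * nat -> int) :
  size c = n.-1 -> size e = 'C(n.-1, 2) ->
  [seq F v | v <- Gfree n] = [seq demand x | x <- c ++ e] <->
  (forall i p, i < n.-1 -> p < n.-1 - i -> F (i.+2, i.+2 + p) = demand (cell n.-1 c e i p)).
Proof.
move=> sc se; rewrite map_Gfree -(flatten_triangle sc se) map_flatten.
have st := shape_triangle sc se.
have szt : size (triangle n.-1 c e) = n.-1.
  by have := congr1 size st; rewrite !size_map size_iota.
have sz i : i < n.-1 -> size (nth [::] (triangle n.-1 c e) i) = n.-1 - i.
  move=> im; have := congr1 (nth 0 ^~ i) st.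
  by rewrite (nth_map [::]) ?szt // (nth_map 0) ?size_iota // nth_iota.
split=> [E i p im pm|H].
  have Es : shape [seq [seq F (k.+2, k.+2 + q) | q <- iota 0 (n.-1 - k)] | k <- iota 0 n.-1] =
      shape [seq [seq demand x | x <- r] | r <- triangle n.-1 c e].
    rewrite /shape -!map_comp [RHS](eq_map (g := size)); last first.
      by move=> s; rewrite /= size_map.
    by rewrite [RHS]st; apply: eq_map => j /=; rewrite size_map size_iota.
  have := congr1 (fun s => nth 0%R (nth [::] s i) p) (eq_from_flatten_shape E Es).
  rewrite (nth_map 0) ?size_iota // (nth_map [::]) ?szt // nth_iota // add0n.
  by rewrite (nth_map 0) ?size_iota // (nth_map 0) ?sz // nth_iota.
congr flatten; apply: (@eq_from_nth _ [::]); rewrite !size_map size_iota ?szt // => i im.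
rewrite (nth_map 0) ?size_iota // (nth_map [::]) ?szt // nth_iota // add0n.
apply: (@eq_from_nth _ 0%R); rewrite !size_map size_iota ?sz // => p pm.
by rewrite (nth_map 0) ?size_iota // (nth_map 0) ?sz // nth_iota // H.
Qed.

Definition flow_rows m (g : (nat * nat) * (nat * nat) -> nat) : seq (seq (nat * nat)) :=
  [seq [seq (left_edge g i p, right_edge g i p) | p <- iota 0 (m - i)] | i <- iota 0 m].

Lemma size_nth_flow_rows m g i : i < m -> size (nth [::] (flow_rows m g) i) = m - i.
Proof. by move=> im; rewrite (nth_map 0) ?size_iota // nth_iota // size_map size_iota. Qed.

Lemma dcell_flow_rows m g i p : i < m -> p < m - i ->
  dcell (flow_rows m g) i p = (left_edge g i p, right_edge g i p).
Proof.
move=> im pm; rewrite /dcell (nth_map 0) ?size_iota // nth_iota // (nth_map 0) ?size_iota //.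
by rewrite nth_iota.
Qed.

Lemma eq_nseq (T : eqType) (s : seq T) (f : T -> int) :
  [seq f v | v <- s] = nseq (size s) 0%R <-> {in s, forall v, f v = 0%R}.
Proof.
have -> : nseq (size s) 0%R = [seq (fun=> 0 : int)%R v | v <- s].
  by elim: s => //= a s ->.
by rewrite -eq_in_map.
Qed.

Lemma size_sink_verts n : 2 <= n -> size (sink_verts n) = (2 * n - 2).+1.
Proof. by move=> n2; rewrite !size_cat !size_map !size_iota /=; lia. Qed.

Lemma size_Gfree n : size (Gfree n) = n.-1 + 'C(n.-1, 2).
Proof.
have := congr1 size (map_Gfree n id); rewrite size_map size_flatten /shape -map_comp => ->.
rewrite (eq_map (g := fun i => n.-1 - i)); last first.
  by move=> i; rewrite /= size_map size_iota.
pose m := n.-1; rewrite -/m.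
have sc : size (nseq m 0) = m by rewrite size_nseq.
have se : size (nseq 'C(m, 2) 0) = 'C(m, 2) by rewrite size_nseq.
by rewrite -(shape_triangle sc se) -size_flatten flatten_triangle // size_cat sc se.
Qed.

Lemma mem_kostant n c e (b : seq int) (f : {ffun 'I_(size (Gedges n)) -> 'I_(\sum_(x <- b) absz x).+1}) :
  2 <= n -> size c = n.-1 -> size e = 'C(n.-1, 2) ->
  b = [seq demand x | x <- c ++ e] ++ nseq (2 * n - 2).+1 0%R ->
  ((size b == size (Gverts n)) &&
      [forall k : 'I_(size (Gverts n)),
         netflow (fun e => val (f e)) (tnth (in_tuple (Gverts n)) k) == nth 0%R b k]) <->
  (forall i p, i < n.-1 -> p < n.-1 - i ->
     net n (edge_fun (fun e => val (f e))) (i.+2, i.+2 + p) = demand (cell n.-1 c e i p)) /\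
  {in sink_verts n, forall v, net n (edge_fun (fun e => val (f e))) v = 0%R}.
Proof.
move=> n2 sc se bE.
set F := net n _.
have sb : size b = size (Gverts n).
  rewrite bE /Gverts -/(sink_verts n) !size_cat size_nseq -(size_sink_verts n2).
  by rewrite size_map size_cat sc se size_Gfree /sink_verts !size_cat.
rewrite sb eqxx /=.
have -> : [forall k : 'I_(size (Gverts n)),
         netflow (fun e => val (f e)) (tnth (in_tuple (Gverts n)) k) == nth 0%R b k] =
   ([seq F v | v <- Gverts n] == b).
  apply/forallP/eqP => [H|H k].
    apply: (@eq_from_nth _ 0%R); rewrite size_map ?sb // => k km.
    have /eqP <- := H (Ordinal km).
    rewrite netflow_net -/F (tnth_nth (0, 0)) /= (nth_map (0, 0)) //.
  by rewrite netflow_net -/F -H (tnth_nth (0, 0)) /= (nth_map (0, 0)).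
rewrite bE /Gverts -/(sink_verts n) map_cat eqseq_cat; last first.
  by rewrite !size_map size_cat sc se size_Gfree.
rewrite -(size_sink_verts n2); split.
  by case/andP => /eqP/(nets_eq F sc se) h1 /eqP/eq_nseq h2.
by case=> /(nets_eq F sc se)/eqP h1 /eq_nseq/eqP h2; apply/andP.
Qed.

(** A flow is determined by its values on the edges leaving the triangle vertices, since the side
    edges carry nothing; reading these values row by row is a bijection onto [flowchains]. *)
Lemma KG_flowcount n c e : 2 <= n -> size c = n.-1 -> size e = 'C(n.-1, 2) ->
  KG n ([seq demand x | x <- c ++ e] ++ nseq (2 * n - 2).+1 0%R) = flowcount n.-1 c e.
Proof.
move=> n2 sc se; set b := _ ++ _; rewrite /KG /kostant -size_flowchains.
have ues := Gedges_uniq n.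
pose hrow (f : {ffun 'I_(size (Gedges n)) -> 'I_(\sum_(x <- b) absz x).+1}) :=
  flow_rows n.-1 (edge_fun (fun e => val (f e))).
apply: (@card_image_seq _ _ _ hrow); rewrite /hrow {hrow}.
- move=> f f'; rewrite !inE => /(mem_kostant _ n2 sc se erefl)[_ f0].
  move=> /(mem_kostant _ n2 sc se erefl)[_ f0'] eqr.
  have [h1 h2] := net_sink_verts0 n2 f0; have [h1' h2'] := net_sink_verts0 n2 f0'.
  apply/ffunP => k; apply/val_inj => /=.
  rewrite -(edge_fun_tnth (fun e => val (f e)) k ues).
  rewrite -(edge_fun_tnth (fun e => val (f' e)) k ues).
  have : tnth (in_tuple (Gedges n)) k \in Gedges n by apply: mem_tnth.
  move: (tnth _ _) => x.
  have free a a' : (a, a') \in Gfree n ->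
      (edge_fun (fun e => val (f e)) ((a, a'), (a.+1, a')) =
       edge_fun (fun e => val (f' e)) ((a, a'), (a.+1, a'))) /\
      (edge_fun (fun e => val (f e)) ((a, a'), (a.+1, a'.+1)) =
       edge_fun (fun e => val (f' e)) ((a, a'), (a.+1, a'.+1))).
    rewrite mem_Gfree => ha.
    have im : a - 2 < n.-1 by lia.
    have pm : a' - a < n.-1 - (a - 2) by lia.
    have := dcell_flow_rows (edge_fun (fun e => val (f e))) im pm.
    rewrite eqr dcell_flow_rows // /left_edge /right_edge.
    have -> : (a - 2).+2 + (a' - a) = a' by lia.
    have -> : (a - 2).+3 = a.+1 by lia.
    have -> : (a - 2).+2 = a by lia.
    by case=> -> ->.
  rewrite /Gedges !mem_cat => /or4P[] /mapP[].
  + by move=> [a a'] /free[h _] ->.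
  + by move=> [a a'] /free[_ h] ->.
  + move=> a; rewrite mem_iota => ha ->.
    have ha' : 3 <= a <= n.+1 by lia.
    by rewrite (h1 a ha').1 (h1' a ha').1.
  + move=> a; rewrite mem_iota => ha ->.
    have ha' : 3 <= a <= n.+1 by lia.
    by rewrite (h1 a ha').2 (h1' a ha').2.
- exact: flowchains_uniq.
- move=> f; rewrite inE => /(mem_kostant _ n2 sc se erefl)[Hf f0].
  have [h1 h2] := net_sink_verts0 n2 f0.
  apply/(mem_flowchains _ sc se); split; first by rewrite size_map size_iota.
  move=> i im; split.
  + exact: size_nth_flow_rows.
  + by rewrite dcell_flow_rows ?subn_gt0 //= /left_edge addn0; apply: (h2 i.+2 _).2; lia.
  + rewrite dcell_flow_rows //= ?/right_edge; try lia.
    have -> : i.+2 + (n.-1 - i.+1) = n by lia.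
    by apply: (h2 i.+2 _).1; lia.
  move=> p pm; rewrite dcell_flow_rows //=.
  have := Hf i p im pm; rewrite net_free // /demand.
  move: (edge_fun _) => G; case: i im pm => [|i] im pm; first by rewrite /=; lia.
  by rewrite /inflow !dcell_flow_rows /=; lia.
move=> d dm.
have dbound i p := flowchains_bound i p sc se dm.
have bsum : \sum_(x <- c ++ e) excess x <= \sum_(x <- b) absz x.
  by rewrite /b [X in _ <= X]big_cat /= [X in _ <= X + _]big_map leq_addr.
(* The flow built from a chain: an edge is a left edge when its ends share the second index, and
   edges starting outside the triangle get 0. *)
pose g (x : (nat * nat) * (nat * nat)) : nat :=
  if x.1 \in Gfree n then
    let q := dcell d (x.1.1 - 2) (x.1.2 - x.1.1) in if x.2.2 == x.1.2 then q.1 else q.2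
  else 0.
have gb x : g x <= \sum_(x <- b) absz x.
  apply: leq_trans bsum; rewrite /g; case: ifP => // _.
  have := dbound (x.1.1 - 2) (x.1.2 - x.1.1).
  by case: ifP => _; lia.
pose f := [ffun k : 'I_(size (Gedges n)) =>
  (inord (g (tnth (in_tuple (Gedges n)) k)) : 'I_(\sum_(x <- b) absz x).+1)].
have fE x : x \in Gedges n -> edge_fun (fun e => val (f e)) x = g x.
  case/seq_tnthP => k ->; rewrite edge_fun_tnth // ffunE /= inordK ?ltnS //.
case/(mem_flowchains _ sc se): (dm) => sd Hd.
have gfree i p : i < n.-1 -> p < n.-1 - i ->
    left_edge g i p = (dcell d i p).1 /\ right_edge g i p = (dcell d i p).2.
  move=> im pm; rewrite /left_edge /right_edge /g /= mem_Gfree.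
  rewrite eqxx (_ : (_.+1 == _) = false); last by lia.
  have -> : [&& 1 < i.+2, i.+1 < i.+2 + p & i.+2 + p <= n] by lia.
  by rewrite addKn subn2.
have efree i p : i < n.-1 -> p < n.-1 - i ->
    left_edge (edge_fun (fun e => val (f e))) i p = (dcell d i p).1 /\
    right_edge (edge_fun (fun e => val (f e))) i p = (dcell d i p).2.
  move=> im pm; have [<- <-] := gfree i p im pm.
  have vG : (i.+2, i.+2 + p) \in Gfree n by rewrite mem_Gfree; lia.
  split; apply: fE; rewrite /Gedges !mem_cat.
    by apply/orP; left; apply/mapP; exists (i.+2, i.+2 + p).
  by apply/orP; right; apply/orP; left; apply/mapP; exists (i.+2, i.+2 + p).
exists f; last first.
  apply: (@eq_from_nth _ [::]); rewrite size_map size_iota ?sd // => i im.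
  have [s1 _ _ _] := Hd i im.
  apply: (@eq_from_nth _ (0, 0)); rewrite size_nth_flow_rows ?s1 // => p pm.
  rewrite -!/(dcell _ i p) dcell_flow_rows //.
  by have [-> ->] := efree i p im pm; case: (dcell _ _ _).
rewrite inE; apply/(mem_kostant _ n2 sc se erefl); split.
  move=> i p im pm; rewrite net_free //.
  have [-> ->] := efree i p im pm.
  have [_ _ _ /(_ p pm)] := Hd i im; rewrite /demand.
  case: i im pm => [|i] im pm /=; first by lia.
  have pm' : p < n.-1 - i by lia.
  have pm2 : p.+1 < n.-1 - i by lia.
  have [_ ->] := efree i p (ltnW im) pm'; have [-> _] := efree i p.+1 (ltnW im) pm2.
  by lia.
have g0 a a' a2 a3 : (a, a') \notin Gfree n -> g ((a, a'), (a2, a3)) = 0.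
  by rewrite /g /= => /negPf ->.
have netE v : net n (edge_fun (fun e => val (f e))) v = net n g v.
  rewrite /net; congr (_%:Z - _%:Z)%R; rewrite big_seq_cond [RHS]big_seq_cond;
    by apply: eq_bigr => x /andP[xG _]; rewrite fE.
move=> v vs; rewrite netE; move: vs; rewrite !mem_cat => /or3P[].
(* The only edge from the triangle into [v_{i,i-1}] is the left edge of a diagonal vertex, which
   carries 0 in a chain; on the opposite side the same holds for the last right edge of a row. *)
- case/mapP => -[|[|a]]; rewrite mem_iota => ha -> //.
  have E1 : g ((a.+1, a.+1), (a.+2, a.+1)) = 0.
    have im : a.-1 < n.-1 by lia.
    have [_ l0 _ _] := Hd a.-1 im.
    have [h _] := gfree a.-1 0 im (ltac:(lia)).
    move: h; rewrite l0 /left_edge addn0.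
    by have -> : a.-1.+2 = a.+1 by lia.
  rewrite /net /= sum_out sum_in E1 !if_same !g0 ?mem_Gfree ?if_same //; lia.
- case/mapP => -[|a]; rewrite mem_iota => ha -> //.
  have E1 : g ((a, n), (a.+1, n.+1)) = 0.
    have im : a - 2 < n.-1 by lia.
    have [_ _ r0 _] := Hd (a - 2) im.
    have [_ h] := gfree (a - 2) (n.-1 - (a - 2).+1) im (ltac:(lia)).
    move: h; rewrite r0 /right_edge.
    have -> : (a - 2).+2 = a by lia.
    by have -> : a + (n.-1 - (a - 2).+1) = n by lia.
  rewrite /net /= sum_out sum_in E1 !if_same !g0 ?mem_Gfree ?if_same //; lia.
rewrite inE => /eqP ->; rewrite /net sum_out sum_in !g0 ?mem_Gfree ?if_same //; lia.
Qed.

(** * Shifted tableaux *)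

Lemma count_initial (P : pred nat) n : (forall i j, i <= j -> j < n -> P j -> P i) ->
  forall k, k < n -> P k = (k < \sum_(i < n) P i).
Proof.
elim: n => // n IHn HP k; rewrite ltnS => kn; rewrite big_ord_recr /=.
have HP' i j : i <= j -> j < n -> P j -> P i by move=> ij jn; apply: HP => //; lia.
have le_n : \sum_(i < n) P i <= n.
  by rewrite -[X in _ <= X]card_ord -sum1_card; apply: leq_sum => i _; case: (P i).
case Pn : (P n); last first.
  move: kn; rewrite leq_eqVlt => /orP[/eqP ->|kn]; first by rewrite Pn addn0 ltnNge le_n.
  by rewrite addn0; apply: IHn.
have -> : \sum_(i < n) P i = n.
  rewrite (eq_bigr (fun=> 1)) ?sum_nat_const ?card_ord ?muln1 // => i _.
  by rewrite (HP i n) // ltnW.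
by rewrite (HP k n) //; lia.
Qed.

Section Peel.
Variables (m : nat) (b : seq nat).

Definition psum (b : seq nat) i := \sum_(k < i) nth 0 b k.
Let B i := psum b i.
Let d i := i.+1 + B i.

Lemma psumS (c : seq nat) i : psum c i.+1 = psum c i + nth 0 c i.
Proof. by rewrite /psum big_ord_recr. Qed.

Lemma leq_psum (c : seq nat) i j : i <= j -> psum c i <= psum c j.
Proof.
move=> ij; rewrite -(subnKC ij); elim: (j - i) => [|k IHk]; first by rewrite addn0.
by rewrite addnS psumS; apply: leq_trans IHk (leq_addr _ _).
Qed.

(* [squeeze] is the rank among the values off the diagonal [d], [spread] its inverse: [B k] is the
   number of such values below [d k]. *)
Definition squeeze v := v - \sum_(k < m.+2) (d k < v).
Definition spread x := x + \sum_(k < m.+2) (B k < x).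

Lemma count_diag v k : k < m.+2 -> (d k < v) = (k < \sum_(k < m.+2) (d k < v)).
Proof.
apply: (@count_initial (fun k => d k < v)) => i j ij jn; rewrite /d.
by have := leq_psum b ij; rewrite -!/(B _); lia.
Qed.

Lemma count_below x k : k < m.+2 -> (B k < x) = (k < \sum_(k < m.+2) (B k < x)).
Proof.
apply: (@count_initial (fun k => B k < x)) => i j ij jn.
by have := leq_psum b ij; rewrite -!/(B _); lia.
Qed.

Lemma count_le (P : pred nat) n : \sum_(i < n) P i <= n.
Proof.
rewrite -[X in _ <= X]card_ord -sum1_card; apply: leq_sum => i _.
by case: (P i).
Qed.

Lemma diag_lt_spread x k : k < m.+2 -> (d k < spread x) = (B k < x).
Proof.
move=> kn; have := count_below x kn; rewrite /spread; set q := \sum_(_ < _) _.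
by rewrite /d; lia.
Qed.

Lemma spread_neq_diag x k : k < m.+2 -> spread x != d k.
Proof.
move=> kn; have := count_below x kn; rewrite /spread; set q := \sum_(_ < _) _.
by rewrite /d; lia.
Qed.

Lemma spreadK : cancel spread squeeze.
Proof.
move=> x; rewrite /squeeze; under eq_bigr => k _ do rewrite diag_lt_spread //.
by rewrite /spread addnK.
Qed.

Lemma leq_spread x y : x < y -> spread x < spread y.
Proof.
move=> xy; rewrite /spread -addSn leq_add //; apply: leq_sum => k _.
by case: (ltnP (B k) x) => // h; rewrite (_ : B k < y) //; lia.
Qed.

(** If [q] diagonal values lie below [v], then exactly [q] of the [B k] lie below [v - q]. By
    monotonicity it suffices to compare [v] with its two neighbours [d q.-1] and [d q]. *)
Lemma squeezeK v : (forall k, k < m.+2 -> v != d k) -> spread (squeeze v) = v.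
Proof.
move=> vd; rewrite /spread.
have qE : \sum_(k < m.+2) (B k < squeeze v) = \sum_(k < m.+2) (d k < v).
  have h k : k < m.+2 -> (d k < v) = (k < \sum_(k < m.+2) (d k < v)) by apply: count_diag.
  rewrite /squeeze; move: h; set q := \sum_(_ < _) (d _ < v) => h.
  have qm : q <= m.+2 by apply: (count_le (fun k => d k < v)).
  rewrite -[RHS]/(q); transitivity (\sum_(k < m.+2) (d k < v)) => //.
  apply: eq_bigr => k _; congr nat_of_bool; rewrite h //.
  case: (ltnP k q) => kq.
    have hq : q.-1 < m.+2 by lia.
    have := h q.-1 hq; rewrite /d; have := @leq_psum b k q.-1; rewrite -!/(B _).
    by lia.
  have hq : q < m.+2 by have := ltn_ord k; lia.
  have := h q hq; have := vd q hq; rewrite /d; have := @leq_psum b q k; rewrite -!/(B _).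
  by lia.
rewrite qE /squeeze.
have h k : k < m.+2 -> (d k < v) = (k < \sum_(k < m.+2) (d k < v)) by apply: count_diag.
move: h; set q := \sum_(_ < _) (d _ < v) => h.
have qm : q <= m.+2 by apply: (count_le (fun k => d k < v)).
have := h q.-1; rewrite /d; lia.
Qed.

Lemma squeeze_gt0 v : 0 < v -> (forall k, k < m.+2 -> v != d k) -> 0 < squeeze v.
Proof.
move=> v0 vd; have := squeezeK vd; case: (squeeze v) => // h.
by move: h v0; rewrite /spread big1 // => <-.
Qed.

Lemma ltn_squeeze u v : (forall k, k < m.+2 -> u != d k) ->
  (forall k, k < m.+2 -> v != d k) -> u < v -> squeeze u < squeeze v.
Proof.
move=> ud vd; rewrite -{1}(squeezeK ud) -{1}(squeezeK vd) ltnNge.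
apply: contraR; rewrite -leqNgt leq_eqVlt => /orP[/eqP -> //|/leq_spread/ltnW //].
Qed.

Lemma squeeze_leq v : v <= d m.+1 -> (forall k, k < m.+2 -> v != d k) ->
  squeeze v <= B m.+1.
Proof.
move=> vN vd; rewrite leqNgt -(diag_lt_spread (squeeze v) (ltnSn m.+1)) squeezeK //.
by rewrite -leqNgt.
Qed.

End Peel.

(** Stated for functions on all of [nat], so that tableaux of different sides can be compared
    without changing index types. *)
Record shifted_tableau (n : nat) (t : nat -> nat -> nat) : Prop := ShiftedTableau {
  st_pos : forall i j, i <= j -> j < n -> 0 < t i j <= 'C(n.+1, 2);
  st_inj : forall i j i' j', i <= j -> j < n -> i' <= j' -> j' < n ->
    t i j = t i' j' -> i = i' /\ j = j';
  st_surj : forall k, 0 < k <= 'C(n.+1, 2) -> exists i j, [/\ i <= j, j < n & t i j = k];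
  st_col : forall i j, i < j -> j < n -> t i j < t i.+1 j;
  st_row : forall i j, i <= j -> j.+1 < n -> t i j < t i j.+1 }.

(** Every other cell has a larger neighbour: below it when it is off the diagonal, to its right when
    it is on the diagonal. *)
Lemma st_max n t : shifted_tableau n.+1 t -> t n n = 'C(n.+2, 2).
Proof.
move=> st; have [|i [j [ij jn tE]]] := st_surj st (k := 'C(n.+2, 2)).
  by rewrite bin_gt0 leqnn.
have nle k l : k <= l -> l < n.+1 -> 'C(n.+2, 2) < t k l -> False.
  by move=> kl ln; case/andP: (st_pos st kl ln) => _; lia.
have [iltj|] := ltnP i j.
  by case: (nle i.+1 j iltj jn); rewrite -tE; apply: st_col st _ _ iltj jn.
move=> ji; have eij : i = j by lia.
subst i; have [jn1|] := ltnP j.+1 n.+1.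
  by case: (nle j j.+1 (leqnSn j) jn1); rewrite -tE; apply: st_row st _ _ _ jn1.
move=> nj; have e : j = n by lia.
by subst j.

Qed.

Section PeelTableau.
Variables (m : nat) (b : seq nat).
Let d i := i.+1 + psum b i.

(** Deleting the diagonal moves the columns one step to the left, so the cells just above the old
    diagonal form the new one. *)
Definition peel (t : nat -> nat -> nat) i j := squeeze m b (t i j.+1).
Definition unpeel (t : nat -> nat -> nat) i j :=
  if i < j then spread m b (t i j.-1) else d j.

Hypothesis sumb : psum b m.+1 = 'C(m.+2, 2).

Lemma diag_max : d m.+1 = 'C(m.+3, 2).
Proof. by rewrite /d sumb [in RHS]binS bin1 addnC. Qed.

(** The bounds on the new diagonal come from [t i i < t i i.+1 < t i.+1 i.+1], transported by
    [diag_lt_spread]. *)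
Lemma peel_tableau t : shifted_tableau m.+2 t -> (forall i, i < m.+2 -> t i i = d i) ->
  shifted_tableau m.+1 (peel t) /\
  (forall i, i < m.+1 -> psum b i < peel t i i <= psum b i.+1).
Proof.
move=> st td.
have nd i j : i < j -> j < m.+2 -> forall k, k < m.+2 -> t i j != d k.
  move=> ij jm k km; rewrite -td //; apply/eqP => /(st_inj st (ltnW ij) jm (leqnn k) km).
  by lia.
have sp i j : i <= j -> j < m.+1 -> spread m b (peel t i j) = t i j.+1.
  by move=> ij jm; apply: squeezeK; apply: nd.
split.
  split=> [i j ij jm|i j i' j' ij jm ij' jm'|k km|i j ij jm|i j ij jm].
  - have nd' := nd i j.+1 ij jm.
    have /andP[t0 tN] := st_pos st (leqW ij : i <= j.+1) jm.
    rewrite /peel squeeze_gt0 //= -sumb; apply: squeeze_leq => //.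
    by rewrite -/(d m.+1) diag_max.
  - move=> /(congr1 (spread m b)); rewrite !sp // => /(st_inj st (leqW ij : i <= j.+1) jm (leqW ij') jm').
    by lia.
  - have [|i [j [ij jm tE]]] := st_surj st (k := spread m b k).
      have := count_le (fun i => psum b i < k) m.+2; rewrite /spread.
      by rewrite binS bin1; lia.
    have iltj : i < j.
      rewrite ltn_neqAle ij andbT; apply/eqP => eij; subst i.
      by move/eqP: tE; rewrite td // eq_sym; apply/negP/spread_neq_diag.
    case: j {ij} iltj jm tE => // j ij jm tE; exists i, j; split=> //.
    by rewrite /peel tE spreadK.
  - by apply: ltn_squeeze; [apply: nd; lia | apply: nd; lia | apply: st_col st _ _ _ _; lia].
  - by apply: ltn_squeeze; [apply: nd; lia | apply: nd; lia | apply: st_row st _ _ _ _; lia].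
move=> i im; have := sp i i (leqnn i) im => spE.
rewrite -(@diag_lt_spread m b) ?(leq_trans im) // [X in _ && X]leqNgt.
rewrite -(@diag_lt_spread m b) // spE -!/(d _) -!td ?(leq_trans im) //.
by rewrite (st_row st) // -leqNgt ltnW // (st_col st).
Qed.

(** Only the comparisons with the restored diagonal are new, and these are the interlacing bounds
    read backwards. *)
Lemma unpeel_tableau t : shifted_tableau m.+1 t ->
  (forall i, i < m.+1 -> psum b i < t i i <= psum b i.+1) ->
  shifted_tableau m.+2 (unpeel t).
Proof.
move=> st td.
have dle i : i < m.+2 -> d i <= 'C(m.+3, 2).
  by move=> im; rewrite -diag_max /d; have := @leq_psum b i m.+1; lia.
have binE : 'C(m.+3, 2) = 'C(m.+2, 2) + m.+2 by rewrite binS bin1.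
have spread_inj : injective (spread m b) by apply: can_inj (@spreadK m b).
split=> [i j ij jm|i j i' j' ij jm ij' jm'|k km|i j ij jm|i j ij jm]; rewrite /unpeel.
- case: (ltnP i j) => iltj; last by rewrite dle // /d.
  have /andP[t0 tN] := st_pos st (i := i) (j := j.-1) (ltac:(lia)) (ltac:(lia)).
  have := count_le (fun k => psum b k < t i j.-1) m.+2; rewrite /spread; lia.
- case: (ltnP i j) => iltj; case: (ltnP i' j') => iltj'.
  + move/spread_inj => /(st_inj st (i := i) (j := j.-1) (i' := i') (j' := j'.-1)).
    by lia.
  + by move/eqP => h; case/negP: (@spread_neq_diag m b (t i j.-1) j' jm').
  + by move/esym/eqP => h; case/negP: (@spread_neq_diag m b (t i' j'.-1) j jm).
  + move=> h; suff : j = j' by lia.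
    move: h; rewrite /d; case: (ltngtP j j') => // jj'.
      by have := leq_psum b (ltnW jj'); lia.
    by have := leq_psum b (ltnW jj'); lia.
- case: (boolP [exists i : 'I_m.+2, k == d i]) => [/existsP[i /eqP kE]|].
    by exists i, i; rewrite ltnn; split.
  rewrite negb_exists => /forallP kd.
  have kd' i : i < m.+2 -> k != d i by move=> im; apply: (kd (Ordinal im)).
  have [|i [j [ij jm tE]]] := st_surj st (k := squeeze m b k).
    case/andP: km => k0 kN; rewrite squeeze_gt0 //= -sumb; apply: squeeze_leq => //.
    by rewrite -/(d m.+1) diag_max.
  exists i, j.+1; rewrite !ltnS ij; split=> //; first by lia.
  by rewrite /= tE squeezeK.
- rewrite ij; case: (ltnP i.+1 j) => ij1.
    by apply: leq_spread; apply: st_col st _ _ _ _; lia.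
  have ej : j = i.+1 by lia.
  subst j; rewrite /= ltn_neqAle spread_neq_diag //= leqNgt.
  by rewrite /d diag_lt_spread // -leqNgt; case/andP: (td i jm).
- rewrite ltnS ij; case: (ltnP i j) => ij1 /=.
    apply: leq_spread; case: j ij jm ij1 => // j ij jm ij1; apply: st_row st _ _ _ _; lia.
  have ej : j = i by lia.
  by subst j; rewrite /d diag_lt_spread //; [case/andP: (td i jm) | lia].
Qed.

End PeelTableau.

Lemma st_min n t : 0 < n -> shifted_tableau n t -> t 0 0 = 1.
Proof.
move=> n0 st; have [|i [j [ij jn tE]]] := st_surj st (k := 1).
  by rewrite bin_gt0 ltnS.
have pos k l : k <= l -> l < n -> 0 < t k l by move=> kl ln; case/andP: (st_pos st kl ln).
have [iltj|ji] := ltnP i j.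
  case: j ij jn tE iltj => // j ij jn tE iltj.
  have ij' : i <= j by lia.
  by have := st_row st ij' jn; have := pos i j ij' (ltnW jn); lia.
have eij : i = j by lia.
subst i; case: j ij jn tE ji => [//|j ij jn tE ji].
by have := st_col st (ltnSn j) jn; have := pos j j.+1 (leqnSn j) jn; lia.
Qed.

Lemma is_shSYTP n (T : {ffun 'I_n * 'I_n -> 'I_('C(n.+1, 2)).+1}) :
  is_shSYT T <-> (forall p : 'I_n * 'I_n, p.2 < p.1 -> val (T p) = 0) /\ shifted_tableau n (aget T).
Proof.
have tE i j (im : i < n) (jm : j < n) := aget_small T im jm.
split.
  case/and5P => /forallP h1 /forallP h2 /forallP h3 /forallP h4 /forallP h5; split.
    by move=> p hp; apply/eqP; apply: (implyP (h1 p)).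
  split=> [i j ij jn|i j i' j' ij jn ij' jn'|k km|i j ij jn|i j ij jn].
  - rewrite (tE i j (leq_ltn_trans ij jn) jn).
    by rewrite (implyP (h2 (_, _))) //= -ltnS ltn_ord.
  - rewrite (tE i j (leq_ltn_trans ij jn) jn) (tE i' j' (leq_ltn_trans ij' jn') jn').
    move=> /val_inj eT.
    have /forallP/(_ (Ordinal (leq_ltn_trans ij' jn'), Ordinal jn')) :=
      h3 (Ordinal (leq_ltn_trans ij jn), Ordinal jn).
    by rewrite /= ij ij' eT eqxx /= => /eqP[-> ->].
  - have kb : k < ('C(n.+1, 2)).+1 by lia.
    have /implyP/(_ (ltac:(rewrite /=; lia)))/existsP[[i j] /andP[/= ij /eqP Tk]] := h4 (Ordinal kb).
    by exists i, j; rewrite aget_ord Tk; split.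
  - have /forallP/(_ (Ordinal jn))/andP[/implyP h _] := h5 (Ordinal (ltn_trans ij jn)).
    exact: h.
  have /forallP/(_ (Ordinal (ltnW jn)))/andP[_ /implyP h] := h5 (Ordinal (leq_ltn_trans ij (ltnW jn))).
  by apply: h; rewrite /= ij jn.
case=> h0 st; apply/and5P; split; apply/forallP.
- by move=> p; apply/implyP => hp; apply/eqP/h0.
- move=> [i j]; apply/implyP => /= ij.
  by have := st_pos st ij (ltn_ord j); rewrite aget_ord => /andP[].
- move=> [i j]; apply/forallP => -[i' j']; apply/implyP => /and3P[/= ij ij' /eqP eT].
  have := @st_inj _ _ st i j i' j' ij (ltn_ord j) ij' (ltn_ord j').
  by rewrite !aget_ord eT => /(_ erefl)[/val_inj -> /val_inj ->].
- move=> k; apply/implyP => k0.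
  have [|i [j [ij jn tk]]] := st_surj st (k := k); first by rewrite k0 -ltnS ltn_ord.
  apply/existsP; exists (Ordinal (leq_ltn_trans ij jn), Ordinal jn); rewrite /= ij /=.
  by apply/eqP/val_inj; rewrite /= -tk (tE i j (leq_ltn_trans ij jn) jn).
move=> i; apply/forallP => j; apply/andP; split; apply/implyP.
  by move=> ij; apply: (st_col st ij (ltn_ord j)).
by case/andP => ij jn; apply: (st_row st ij jn).
Qed.

Definition tableaux_diag n (b : seq nat) :=
  [set T : {ffun 'I_n * 'I_n -> 'I_('C(n.+1, 2)).+1} | is_shSYT T &&
       [forall i : 'I_n, aget T i i == i.+1 + psum b i]].

Lemma Nsh_card n b : Nsh n b = #|tableaux_diag n b|.
Proof. by []. Qed.

Definition tableaux_between m (b : seq nat) :=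
  [set T : {ffun 'I_m.+1 * 'I_m.+1 -> 'I_('C(m.+2, 2)).+1} | is_shSYT T &&
       [forall i : 'I_m.+1, psum b i < aget T i i <= psum b i.+1]].

Lemma aget_ffun n K (t : nat -> nat -> nat) i j :
  i < n -> j < n -> t i j < K.+1 ->
  aget [ffun p : 'I_n * 'I_n => (inord (t p.1 p.2) : 'I_K.+1)] i j = t i j.
Proof.
by move=> im jm tK; rewrite (aget_small _ im jm) ffunE /= inordK.
Qed.

Lemma eq_tableau n (t u : nat -> nat -> nat) :
  (forall i j, i <= j -> j < n -> t i j = u i j) -> shifted_tableau n t -> shifted_tableau n u.
Proof.
move=> tu st; split=> [i j ij jn|i j i' j' ij jn ij' jn'|k km|i j ij jn|i j ij jn].
- by rewrite -tu //; apply: st_pos st _ _ ij jn.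
- by rewrite -!tu //; apply: st_inj st _ _ _ _ ij jn ij' jn'.
- have [i [j [ij jn tk]]] := st_surj st km; exists i, j; split=> //; by rewrite -tu.
- by rewrite -!tu //; [apply: st_col st _ _ ij jn | lia].
- by rewrite -!tu //; [apply: st_row st _ _ ij jn | lia | lia].
Qed.

Lemma card_peel m b : psum b m.+1 = 'C(m.+2, 2) ->
  #|tableaux_diag m.+2 b| = #|tableaux_between m b|.
Proof.
move=> sumb.
pose P (T : {ffun 'I_m.+2 * 'I_m.+2 -> 'I_('C(m.+3, 2)).+1}) :
    {ffun 'I_m.+1 * 'I_m.+1 -> 'I_('C(m.+2, 2)).+1} :=
  [ffun p : 'I_m.+1 * 'I_m.+1 => inord ((fun i j => if i <= j then peel m b (aget T) i j else 0) p.1 p.2)].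
have PE T i j : T \in tableaux_diag m.+2 b -> i <= j -> j < m.+1 ->
    aget (P T) i j = peel m b (aget T) i j.
  rewrite inE => /andP[/is_shSYTP[_ st] /forallP Td] ij jm.
  have td i0 : i0 < m.+2 -> aget T i0 i0 = i0.+1 + psum b i0.
    by move=> im; apply/eqP; apply: (Td (Ordinal im)).
  have [st' _] := peel_tableau sumb st td.
  have /andP[_ tN] := st_pos st' ij jm.
  by rewrite (@aget_ffun _ _ (fun i j => if i <= j then peel m b (aget T) i j else 0)) ?ij //; lia.
rewrite [RHS]cardE; apply: (@card_image_seq _ _ _ P).
- move=> T U hT hU eP.
  have := hT; rewrite inE => /andP[/is_shSYTP[T0 st] /forallP Td].
  have := hU; rewrite inE => /andP[/is_shSYTP[U0 su] /forallP Ud].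
  apply/ffunP => -[i j]; apply/val_inj.
  case: (ltngtP i j) => ij; last 1 first.
  + have -> : i = j by apply/val_inj.
    by have /eqP := Td j; have /eqP := Ud j; rewrite !aget_ord => eU eT; exact: etrans eT (esym eU).
  + case: j ij => -[|j] jm // ij.
    have := congr1 (fun V => aget V i j) eP; rewrite !PE //.
    rewrite /peel => /(congr1 (spread m b)).
    have td i0 : i0 < m.+2 -> aget T i0 i0 = i0.+1 + psum b i0.
      by move=> im; apply/eqP; apply: (Td (Ordinal im)).
    have ud i0 : i0 < m.+2 -> aget U i0 i0 = i0.+1 + psum b i0.
      by move=> im; apply/eqP; apply: (Ud (Ordinal im)).
    rewrite !squeezeK; last 2 first.
    * move=> k km; rewrite -ud //; apply/eqP => /(st_inj su (ltnW ij) jm (leqnn k) km).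
      by lia.
    * move=> k km; rewrite -td //; apply/eqP => /(st_inj st (ltnW ij) jm (leqnn k) km).
      by lia.
    by rewrite !(aget_small _ (ltn_ord i) jm); case: i {ij} => i im;
      rewrite (bool_irrelevance (ltn_ord (Ordinal im)) im).
  + by rewrite T0 ?U0.
- exact: enum_uniq.
- move=> T hT; rewrite mem_enum inE.
  have := hT; rewrite inE => /andP[/is_shSYTP[_ st] /forallP Td].
  have td i0 : i0 < m.+2 -> aget T i0 i0 = i0.+1 + psum b i0.
    by move=> im; apply/eqP; apply: (Td (Ordinal im)).
  have [st' ht'] := peel_tableau sumb st td.
  apply/andP; split.
    apply/is_shSYTP; split.
      by move=> [i j] /= ji; rewrite ffunE /= leqNgt ji /= inordK.
    by apply: eq_tableau st' => i j ij jm; rewrite PE.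
  by apply/forallP => i; rewrite PE // ht'.
move=> U; rewrite mem_enum inE => /andP[/is_shSYTP[U0 su] /forallP Ud].
have ud i : i < m.+1 -> psum b i < aget U i i <= psum b i.+1.
  by move=> im; apply: (Ud (Ordinal im)).
have su' := unpeel_tableau sumb su ud.
pose T : {ffun 'I_m.+2 * 'I_m.+2 -> 'I_('C(m.+3, 2)).+1} :=
  [ffun p : 'I_m.+2 * 'I_m.+2 => inord ((fun i j => if i <= j then unpeel m b (aget U) i j else 0) p.1 p.2)].
have TE i j : i <= j -> j < m.+2 -> aget T i j = unpeel m b (aget U) i j.
  move=> ij jm; have /andP[_ tN] := st_pos su' ij jm.
  by rewrite (@aget_ffun _ _ (fun i j => if i <= j then unpeel m b (aget U) i j else 0)) ?ij //; lia.
have hT : T \in tableaux_diag m.+2 b.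
  rewrite inE; apply/andP; split.
    apply/is_shSYTP; split.
      by move=> [i j] /= ji; rewrite ffunE /= leqNgt ji /= inordK.
    by apply: eq_tableau su' => i j ij jm; rewrite TE.
  by apply/forallP => i; rewrite TE // /unpeel ltnn.
exists T => //; apply/ffunP => -[i j]; apply/val_inj => /=.
case: (leqP i j) => ij; last by rewrite U0 // ffunE /= leqNgt ij /= inordK.
have jm : j.+1 < m.+2 by rewrite ltnS.
rewrite -!(aget_ord _ i j) PE // /peel TE //; last exact: leqW.
by rewrite /unpeel ltnS ij /= spreadK.
Qed.

(** * Interlacing diagonals as flows through a row *)

Lemma mem_outflows m b s : size b = m.+1 -> reflect
  [/\ size s = m, forall i, i < m.+1 -> psum b i < i.+1 + psum s i <= psum b i.+1 &
      m.+1 + psum s m = psum b m.+1]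
  (s \in [seq outflow w | w <- splits b]).
Proof.
move=> sb; have b0 : 0 < size b by rewrite sb.
apply: (iffP mapP) => [[w /(mem_splits _ b0) [sw Hw w0 wl] ->]|[ss Hs Hl]].
  rewrite sb in sw Hw wl.
  have ps i : i < m.+1 -> i.+1 + psum (outflow w) i = psum b i + (nthp w i).1.+1.
    elim: i => [|i IHi] im; first by rewrite /psum !big_ord0 w0.
    rewrite !psumS nth_outflow ?sw //; have := IHi (ltnW im); have := Hw i (ltnW im); lia.
  split; first by rewrite size_outflow sw.
    by move=> i im; rewrite ps // psumS -(Hw i im); lia.
  by rewrite ps // psumS -(Hw m) //; have := wl; rewrite /=; lia.
(* The new diagonal entry [i.+1 + psum s i] cuts the interval from [psum b i + 1] to [psum b i.+1]
   into the left and the right flow of vertex [i]. *)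
pose w := [seq (i.+1 + psum s i - (psum b i).+1, psum b i.+1 - (i.+1 + psum s i)) | i <- iota 0 m.+1].
have sw : size w = m.+1 by rewrite size_map size_iota.
have nw i : i < m.+1 -> nthp w i =
    (i.+1 + psum s i - (psum b i).+1, psum b i.+1 - (i.+1 + psum s i)).
  by move=> im; rewrite (nth_map 0) ?size_iota // nth_iota.
exists w.
  apply/(mem_splits _ b0); rewrite sb sw; split=> // [p pm||].
  - by rewrite nw //=; have := Hs p pm; rewrite psumS; lia.
  - by rewrite nw // /psum !big_ord0.
  by rewrite nw //= Hl subnn.
apply: (@eq_from_nth _ 0); rewrite ?size_outflow ?sw ss // => i im.
rewrite nth_outflow ?sw // !nw //=; try lia.
by have := Hs i (leqW im); have := Hs i.+1 im; rewrite (psumS s i); lia.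
Qed.

(** The flows are recovered from left to right: the first left flow is 0, a left flow determines the
    right flow of the same vertex, and the outflow then gives the next left flow. *)
Lemma outflows_uniq m b : size b = m.+1 -> uniq [seq outflow w | w <- splits b].
Proof.
move=> sb; have b0 : 0 < size b by rewrite sb.
rewrite map_inj_in_uniq ?splits_uniq // => w v.
move=> /(mem_splits _ b0) [sw Hw w0 wl] /(mem_splits _ b0) [sv Hv v0 vl] ewv.
rewrite sb in sw Hw sv Hv.
have E i : i < m.+1 -> nthp w i = nthp v i.
  elim: i => [|i IHi] im.
    by apply: injective_projections; [rewrite w0 v0 | have := Hw 0 im; have := Hv 0 im; lia].
  have := congr1 (nth 0 ^~ i) ewv; rewrite !nth_outflow ?sw ?sv // IHi ?(ltnW im) //.
  move/addnI => e1.
  by apply: injective_projections => //; have := Hw i.+1 im; have := Hv i.+1 im; lia.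
by apply: (@eq_from_nth _ (0, 0)); rewrite sw ?sv.
Qed.

Lemma Nsh_ksum m b : size b = m.+1 -> Nsh m.+2 b = ksum b (Nsh m.+1).
Proof.
move=> sb; rewrite ksum_splits Nsh_card -(big_map outflow xpredT (Nsh m.+1)).
set S := map _ _.
have memS s : reflect _ (s \in S) := mem_outflows s sb.
(* The last diagonal entry of a tableau is its maximum. For any other total, neither the larger
   tableau nor a smaller one with an outflow of [b] as diagonal data exists. *)
case: (eqVneq (psum b m.+1) 'C(m.+2, 2)) => sumb; last first.
  transitivity 0.
    apply/eqP; rewrite cards_eq0; apply/eqP/setP => T; rewrite !inE; apply/negP.
    case/andP=> /is_shSYTP[_ /st_max tM] /forallP/(_ ord_max)/eqP /=.
    rewrite tM => E; case/eqP: sumb; move: E; rewrite binS bin1; lia.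
  rewrite big1_seq // => s /= /memS[ss _ Hl]; apply/eqP; rewrite Nsh_card cards_eq0.
  apply/eqP/setP => T; rewrite !inE; apply/negP.
  case/andP=> /is_shSYTP[_ /st_max tM] /forallP/(_ ord_max)/eqP /=.
  by rewrite tM Hl => E; rewrite -E eqxx in sumb.
rewrite card_peel //.
(* Recovers the sequence that describes the diagonal of a tableau; the tableaux are then sorted by
   it. *)
pose dv (T : {ffun 'I_m.+1 * 'I_m.+1 -> 'I_('C(m.+2, 2)).+1}) :=
  mkseq (fun k => aget T k.+1 k.+1 - (aget T k k).+1) m.
have dvE T i : is_shSYT T -> i < m.+1 -> aget T i i = i.+1 + psum (dv T) i.
  case/is_shSYTP => _ st; elim: i => [|i IHi] im.
    by rewrite (st_min _ st) // /psum big_ord0.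
  rewrite psumS nth_mkseq // addSn addnA -IHi ?(ltnW im) //.
  by have := st_row st (leqnn i) im; have := st_col st (ltnSn i) im; lia.
have dvU T s : is_shSYT T -> size s = m ->
    [forall i : 'I_m.+1, aget T i i == i.+1 + psum s i] = (dv T == s).
  move=> hT ss; apply/forallP/eqP => [H|<- i]; last by rewrite -dvE.
  apply: (@eq_from_nth _ 0); rewrite size_mkseq ?ss // => i im.
  rewrite nth_mkseq //; have /eqP := H (Ordinal (leqW im)); have /eqP := H (Ordinal (im : i.+1 < m.+1)).
  by rewrite /= psumS; lia.
have inS T : T \in tableaux_between m b -> dv T \in S.
  rewrite inE => /andP[hT /forallP Tb]; apply/memS; rewrite size_mkseq; split=> //.
    by move=> i im; rewrite -dvE //; apply: (Tb (Ordinal im)).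
  by rewrite -dvE // sumb; case/is_shSYTP: hT => _ /st_max.
transitivity (\sum_(T in tableaux_between m b) \sum_(s <- S) (dv T == s)).
  rewrite -sum1_card; apply: eq_bigr => T /inS TS.
  rewrite (bigD1_seq (dv T)) ?(outflows_uniq sb) //= eqxx big1 // => s.
  by rewrite eq_sym => /negPf ->.
rewrite exchange_big /=; rewrite big_seq [RHS]big_seq; apply: eq_bigr => s sS.
have /memS[ss Hs Hl] := sS.
rewrite Nsh_card -sum1_card big_mkcond [RHS]big_mkcond; apply: eq_bigr => T _.
rewrite !inE; case hT: (is_shSYT T) => //=; rewrite dvU //.
case: eqP => [E|//]; last by case: ifP.
rewrite ifT //; apply/forallP => i; rewrite dvE // E; exact: Hs.
Qed.

Lemma Nsh1 b : Nsh 1 b = 1.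
Proof.
pose T0 : {ffun 'I_1 * 'I_1 -> 'I_('C(2, 2)).+1} := [ffun=> inord 1].
have T0E : aget T0 0 0 = 1 by rewrite (aget_small _ (ltn0Sn 0) (ltn0Sn 0)) ffunE inordK.
rewrite Nsh_card; apply/eqP/cards1P; exists T0; apply/setP => T; rewrite !inE.
apply/andP/eqP => [[_ /forallP/(_ ord0)/eqP]|->].
  rewrite /psum big_ord0 addn0 => T1; apply/ffunP => -[i j]; apply/val_inj.
  by rewrite (ord1 i) (ord1 j) /= -(aget_ord T) -(aget_ord T0) T0E T1.
split; last by apply/forallP => i; rewrite (ord1 i) T0E /psum big_ord0.
apply/is_shSYTP; split; first by move=> [i j]; rewrite (ord1 i) (ord1 j).
by split=> [[|i] [|j]|[|i] [|j] [|i'] [|j']|[|[|k]] //|i [|j]|i [|j]] //;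
  [rewrite T0E | exists 0, 0; rewrite T0E].
Qed.

(** Inner weight 0 means inner demand -1, so that adding the inner weights to an outflow changes
    nothing and the two recursions coincide. *)
Lemma Nsh_flowcount m b : size b = m -> Nsh m.+1 b = flowcount m b (nseq 'C(m, 2) 0).
Proof.
elim: m b => [|m IHm] b sb.
  exact: Nsh1.
rewrite Nsh_ksum //= !ksum_splits; apply: eq_big_seq => w ws.
have b0 : 0 < size b by rewrite sb.
have [sw _ _ _] := mem_splits _ b0 ws.
have so : size (outflow w) = m by rewrite size_outflow sw sb.
rewrite IHm // binS bin1; congr flowcount.
  rewrite addnC nseqD take_size_cat ?size_nseq //.
  by elim: m (outflow w) so {IHm sb} => [|m IHm] [|x s] //= [/IHm E]; rewrite {1}E.
by rewrite addnC nseqD drop_size_cat ?size_nseq.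
Qed.

(** * Scaling limits *)

Section Limits.
Local Open Scope ring_scope.

(** Has the exact form of [GT_volume_is], so a volume statement is directly a limit statement. *)
Definition tends_to (u : nat -> rat) (l : rat) : Prop :=
  forall eps : rat, 0 < eps ->
    exists T : nat, forall t : nat, (T <= t)%N -> (0 < t)%N -> `|u t - l| < eps.

Lemma tends_to_cst l : tends_to (fun=> l) l.
Proof. by move=> eps e0; exists 0%N => t _ _; rewrite subrr normr0. Qed.

Lemma eq_tends_to u v l : (forall t, (0 < t)%N -> u t = v t) -> tends_to u l -> tends_to v l.
Proof. by move=> uv ul eps /ul[T HT]; exists T => t Tt t0; rewrite -uv // HT. Qed.

Lemma tends_toD u v l k : tends_to u l -> tends_to v k -> tends_to (fun t => u t + v t) (l + k).
Proof.
move=> ul vk eps e0; have e2 : 0 < eps / 2%:R by rewrite divr_gt0.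
have [T1 H1] := ul _ e2; have [T2 H2] := vk _ e2; exists (maxn T1 T2) => t.
rewrite geq_max => /andP[t1 t2] t0.
rewrite (_ : _ - _ = (u t - l) + (v t - k)); last by ring.
apply: le_lt_trans (ler_normD _ _) _.
rewrite [ltRHS](_ : eps = eps / 2%:R + eps / 2%:R); last by field.
by apply: ltrD; [apply: H1 | apply: H2].
Qed.

Lemma tends_toM u v l k : tends_to u l -> tends_to v k -> tends_to (fun t => u t * v t) (l * k).
Proof.
move=> ul vk eps e0.
pose M := `|l| + `|k| + 1.
have M0 : 0 < M by rewrite /M; have := normr_ge0 l; have := normr_ge0 k; lra.
(* With both errors below [d <= 1], the error of the product is at most [d * M <= eps / 2]. *)
pose d := Num.min 1 (eps / (2%:R * M)).
have d0 : 0 < d by rewrite lt_min ltr01 divr_gt0 // mulr_gt0.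
have [T1 H1] := ul _ d0; have [T2 H2] := vk _ d0; exists (maxn T1 T2) => t.
rewrite geq_max => /andP[t1 t2] t0.
have h1 := H1 t t1 t0; have h2 := H2 t t2 t0.
rewrite (_ : _ - _ = (u t - l) * (v t - k) + (u t - l) * k + l * (v t - k)); last by ring.
apply: le_lt_trans (ler_normD _ _) _.
apply: le_lt_trans (lerD (ler_normD _ _) (lexx _)) _.
rewrite !normrM.
have d1 : d <= 1 by rewrite ge_min lexx.
have dM : d * (2%:R * M) <= eps.
  by rewrite -ler_pdivlMr ?mulr_gt0 // ge_min lexx orbT.
have h1' : `|u t - l| * `|v t - k| <= d * 1.
  by apply: ler_pM => //; apply: ltW => //; apply: lt_le_trans h2 d1.
have h2' : `|u t - l| * `|k| <= d * `|k| by rewrite ler_wpM2r // ltW.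
have h3' : `|l| * `|v t - k| <= `|l| * d by rewrite ler_wpM2l // ltW.
have := mulr_gt0 d0 M0; rewrite /M in dM *; lra.
Qed.

Lemma tends_to_inv : tends_to (fun t => t%:R^-1) 0.
Proof.
move=> eps e0; exists (Num.bound eps^-1) => t Tt t0.
have tp : 0 < t%:R :> rat by rewrite ltr0n.
rewrite subr0 ger0_norm ?invr_ge0 ?ltW // invf_plt ?posrE //.
apply: lt_le_trans (_ : (Num.bound eps^-1)%:R <= _); last by rewrite ler_nat.
by apply: archi_boundP; rewrite invr_ge0 ltW.
Qed.

Lemma tends_to_sum (I : Type) (r : seq I) (P : pred I) (u : I -> nat -> rat) (l : I -> rat) :
  (forall i, P i -> tends_to (u i) (l i)) ->
  tends_to (fun t => \sum_(i <- r | P i) u i t) (\sum_(i <- r | P i) l i).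
Proof.
move=> ul; elim: r => [|i r IHr].
  by apply: eq_tends_to (tends_to_cst _) => t _; rewrite !big_nil.
rewrite big_cons; case Pi : (P i).
  by apply: eq_tends_to (tends_toD (ul _ Pi) IHr) => t _; rewrite big_cons Pi.
by apply: eq_tends_to IHr => t _; rewrite big_cons Pi.
Qed.

Lemma tends_to_prod (I : Type) (r : seq I) (P : pred I) (u : I -> nat -> rat) (l : I -> rat) :
  (forall i, P i -> tends_to (u i) (l i)) ->
  tends_to (fun t => \prod_(i <- r | P i) u i t) (\prod_(i <- r | P i) l i).
Proof.
move=> ul; elim: r => [|i r IHr].
  by apply: eq_tends_to (tends_to_cst _) => t _; rewrite !big_nil.
rewrite big_cons; case Pi : (P i).
  by apply: eq_tends_to (tends_toM (ul _ Pi) IHr) => t _; rewrite big_cons Pi.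
by apply: eq_tends_to IHr => t _; rewrite big_cons Pi.
Qed.

Lemma tends_to_unique u l k : tends_to u l -> tends_to u k -> l = k.
Proof.
move=> ul uk; apply/eqP; rewrite -subr_eq0 -normr_le0 leNgt; apply/negP => e0.
have e2 : 0 < `|l - k| / 2%:R by rewrite divr_gt0.
have [T1 H1] := ul _ e2; have [T2 H2] := uk _ e2.
pose t := (maxn T1 T2).+1.
have t1 : (T1 <= t)%N by rewrite leqW // leq_maxl.
have t2 : (T2 <= t)%N by rewrite leqW // leq_maxr.
have := H1 t t1 isT; have := H2 t t2 isT.
have : `|l - k| <= `|u t - l| + `|u t - k|.
  by rewrite (distrC (u t) l) (_ : l - k = (l - u t) + (u t - k)) ?ler_normD //; ring.
by lra.
Qed.

Lemma tends_to_affine (a c : rat) : tends_to (fun t => (t%:R * a + c) / t%:R) a.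
Proof.
have := tends_toD (tends_to_cst a) (tends_toM (tends_to_cst c) tends_to_inv).
rewrite mulr0 addr0; apply: eq_tends_to => t t0.
have tn : t%:R != 0 :> rat by rewrite pnatr_eq0 -lt0n.
by field.
Qed.

Lemma bin_rat (x s : nat) : ('C(x, s))%:R = \prod_(k < s) (x%:R - k%:R) / (s`!)%:R :> rat.
Proof.
have f0 : (s`!)%:R != 0 :> rat by rewrite pnatr_eq0 -lt0n fact_gt0.
apply: (canRL (mulfK f0)); rewrite -natrM bin_ffact.
elim: s {f0} => [|s IHs]; first by rewrite big_ord0 ffactn0.
rewrite big_ord_recr /= -IHs ffactnSr natrM.
case: (leqP s x) => sx; first by rewrite natrB.
by rewrite ffact_small // !mul0r.
Qed.

(** Each of the [s] factors [t a + 1 - k], divided by [t], tends to [a]. *)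
Lemma tends_to_bin (a s : nat) :
  tends_to (fun t => ('C((t * a).+1, s))%:R / t%:R ^+ s) (a%:R ^+ s / (s`!)%:R).
Proof.
have -> : a%:R ^+ s = \prod_(k < s) a%:R :> rat by rewrite prodr_const card_ord.
apply: eq_tends_to (tends_toM (@tends_to_prod _ (index_enum 'I_s) xpredT
  (fun k t => (t%:R * a%:R + (1 - (k : nat)%:R)) / t%:R) (fun=> a%:R) _) (tends_to_cst _)).
  move=> t t0; rewrite prodf_div prodr_const card_ord bin_rat mulrAC; congr (_ / _ / _).
  by apply: eq_bigr => k _; rewrite -addn1 natrD natrM addrA.
by move=> k _; apply: tends_to_affine.
Qed.

Lemma prod_pairs_const (x : rat) n : \prod_(i < n) \prod_(j < n | (i < j)%N) x = x ^+ 'C(n, 2).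
Proof.
rewrite (exchange_big_dep xpredT) //= -(bin2_sum n) big_mkord -prodrXr.
apply: eq_bigr => j _; rewrite -(big_ord_widen n (fun=> x)) ?prodr_const ?card_ord //.
exact: ltnW.
Qed.

Lemma tends_to_latt_prod n lam : size lam = n ->
  tends_to (fun t => latt_prod n (map (muln t) lam) / t%:R ^+ 'C(n, 2)) (vol_prod n lam).
Proof.
move=> sl; apply: (@eq_tends_to (fun t => \prod_(i < n) \prod_(j < n | (i < j)%N)
   ((t%:R * ((nth 0%N lam i)%:R - (nth 0%N lam j)%:R) + (j - i)%:R) / t%:R / (j - i)%:R))).
  move=> t t0; rewrite /latt_prod -prod_pairs_const -prodf_div; apply: eq_bigr => i _.
  rewrite -prodf_div; apply: eq_bigr => j _.
  by rewrite !(nth_map 0%N) ?sl // !natrM -mulrBr mulrAC.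
apply: tends_to_prod => i _; apply: tends_to_prod => j _.
by apply: tends_toM (tends_to_cst _); apply: tends_to_affine.
Qed.

Lemma GT_volume n lam : (2 <= n)%N -> size lam = n -> sorted geq lam ->
  GT_volume_is n lam (vol_prod n lam).
Proof.
move=> n2 sl sorl; apply: eq_tends_to (tends_to_latt_prod sl) => t t0.
rewrite card_GT_grid_points // gtpatterns_latt_prod ?size_map //; first by lia.
apply: (homo_sorted (e := geq) (e' := geq)) sorl => x y /=.
by rewrite leq_mul2l => ->; rewrite orbT.
Qed.

End Limits.

(** * Sums over boxes and the comparison of leading terms *)

Fixpoint box (D N : nat) : seq (seq nat) :=
  if N is N'.+1 then [seq x :: s | x <- iota 0 D.+1, s <- box D N'] else [:: [::]].

Lemma boxS D N : box D N.+1 = [seq x :: s | x <- iota 0 D.+1, s <- box D N].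
Proof. by []. Qed.

Lemma mem_box D N s : (s \in box D N) = (size s == N) && all (fun x => x <= D) s.
Proof.
elim: N s => [|N IHN] s; first by rewrite inE; case: s.
rewrite boxS; apply/allpairsP/idP => [[[x u] [xD uB ->]]|].
  by rewrite mem_iota add0n /= in xD; rewrite IHN in uB;
    case/andP: uB => /= /eqP -> ->; rewrite eqxx andbT; lia.
case: s => [|x u] // /andP[su /andP[xD uD]]; exists (x, u); split=> //.
  by rewrite mem_iota /=; lia.
by rewrite /= IHN -eqSS su.
Qed.

Lemma box_uniq D N : uniq (box D N).
Proof.
elim: N => [|N IHN] //; rewrite boxS; apply: allpairs_uniq; rewrite ?iota_uniq //.
by move=> [a b] [c d] _ _ /= [-> ->].
Qed.

Definition ffun_seq D N (j : {ffun 'I_N -> 'I_D.+1}) : seq nat := [seq val (j k) | k <- enum 'I_N].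

Lemma size_ffun_seq D N (j : {ffun 'I_N -> 'I_D.+1}) : size (ffun_seq j) = N.
Proof. by rewrite size_map size_enum_ord. Qed.

Lemma nth_ffun_seq D N (j : {ffun 'I_N -> 'I_D.+1}) (k : 'I_N) : nth 0 (ffun_seq j) k = j k.
Proof. by rewrite (nth_map k) ?size_enum_ord // nth_ord_enum. Qed.

Lemma sumn_ffun_seq D N (j : {ffun 'I_N -> 'I_D.+1}) : sumn (ffun_seq j) = \sum_(k < N) val (j k).
Proof.
rewrite sumnE (big_nth 0) size_ffun_seq big_mkord.
by apply: eq_bigr => k _; rewrite nth_ffun_seq.
Qed.

Lemma sum_ffun_box (R : nmodType) D N (F : seq nat -> R) :
  (\sum_(j : {ffun 'I_N -> 'I_D.+1}) F (ffun_seq j) = \sum_(s <- box D N) F s)%R.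
Proof.
rewrite -(big_map (@ffun_seq D N) xpredT F); apply: perm_big; apply: uniq_perm.
- rewrite map_inj_uniq ?index_enum_uniq // => i j eij; apply/ffunP => k.
  by apply/val_inj; rewrite /= -!nth_ffun_seq eij.
- exact: box_uniq.
move=> s; rewrite mem_box; apply/mapP/andP => [[j _ ->]|[/eqP ss /allP sD]].
  rewrite size_ffun_seq eqxx; split=> //; apply/allP => _ /mapP[k _ ->].
  by rewrite -ltnS ltn_ord.
exists [ffun k : 'I_N => inord (nth 0 s k)]; first by rewrite mem_index_enum.
apply: (@eq_from_nth _ 0); rewrite ?size_ffun_seq ss // => k kN.
rewrite (nth_ffun_seq _ (Ordinal kN)) ffunE inordK // ltnS.
by apply: sD; rewrite mem_nth // ss.
Qed.

(** The two sums differ in their ranges only: beyond [x_i] the binomial coefficient vanishes, and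
    beyond [D] the hypothesis makes [F] vanish. *)
Lemma binsum_box D x F :
  (forall s, size s = size x -> F s != 0 -> all (fun y => y <= D) s) ->
  binsum x F = \sum_(s <- box D (size x)) (\prod_(i < size x) 'C(nth 0 x i, nth 0 s i)) * F s.
Proof.
elim: x F => [|a x IHx] F HF; first by rewrite big_seq1 big_ord0 mul1n.
rewrite [size _]/= boxS big_allpairs_dep (sum_iota_add 0 D.+1 (fun j => \sum_(s <- box D (size x))
  (\prod_(i < (size x).+1) 'C(nth 0 (a :: x) i, nth 0 (j :: s) i)) * F (j :: s))).
pose G j := 'C(a, j) * binsum x (fun s => F (j :: s)).
have HG j : D < j -> binsum x (fun s => F (j :: s)) = 0.
  move=> Dj; rewrite -[RHS](binsum0 x); apply: eq_binsum => s ss.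
  apply/eqP; apply: contraT => /HF; rewrite /= ss => /(_ erefl)/andP[]; lia.
transitivity (\sum_(j < D.+1) G j).
  rewrite -[LHS]/(\sum_(j < a.+1) G j) -(@sum_ord_widen a.+1 (maxn a.+1 D.+1) G) ?leq_maxl //; last first.
    by move=> j ja; rewrite /G bin_small.
  rewrite (@sum_ord_widen D.+1 (maxn a.+1 D.+1) G) ?leq_maxr // => j Dj.
  by rewrite /G HG // muln0.
apply: eq_bigr => j _; rewrite /G IHx; last first.
  by move=> s ss /HF; rewrite /= ss => /(_ erefl)/andP[].
rewrite add0n big_distrr /=; apply: eq_bigr => s _.
by rewrite big_ord_recl /= mulnA.
Qed.

Lemma binsum_nseq0 k F : binsum (nseq k 0) F = F (nseq k 0).
Proof. by elim: k F => [|k IHk] F //=; rewrite big_ord1 mul1n IHk. Qed.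

Lemma binsum_nseq1 k F : (forall e, size e = k -> sumn e != 0 -> F e = 0) ->
  binsum (nseq k 1) F = F (nseq k 0).
Proof.
elim: k F => [|k IHk] F HF //=; rewrite !big_ord_recl big_ord0 /= addn0 !mul1n IHk.
  rewrite (@eq_binsum _ _ (fun=> 0)) ?binsum0 ?muln0 ?addn0 // => s ss.
  by apply: HF; rewrite //= ss size_nseq.
by move=> e se es; apply: HF; rewrite /= ?se.
Qed.

Lemma leq_all_sumn s D : sumn s <= D -> all (fun x => x <= D) s.
Proof.
elim: s D => [|x s IHs] D //= h; rewrite IHs ?andbT; lia.
Qed.

(** * The two expansions over flows *)

Definition latt_caps n lam := mkseq (latt_cap n lam) (rr n).

Lemma rrE n : 2 <= n -> rr n = n.-1 + ('C(n.-1, 2) + (2 * n - 2)).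
Proof.
case: n => // n n2; rewrite /rr (binS n.+2 1) (binS n.+1 1) (binS n 1) !bin1 /=; lia.
Qed.

Lemma bin2_pred n : 2 <= n -> 'C(n, 2) = n.-1 + 'C(n.-1, 2).
Proof. by case: n => // n _; rewrite binS bin1 addnC. Qed.

Lemma latt_capsE n lam : 2 <= n -> size lam = n ->
  latt_caps n lam = map S (diffs lam) ++ (nseq 'C(n.-1, 2) 1 ++ nseq (2 * n - 2) 0).
Proof.
move=> n2 sl; have binE := bin2_pred n2.
apply: (@eq_from_nth _ 0).
  by rewrite !size_cat size_mkseq size_map !size_nseq size_diffs sl rrE.
move=> k; rewrite size_mkseq rrE // => kr; rewrite nth_mkseq ?rrE // /latt_cap.
rewrite !nth_cat size_map size_diffs sl size_nseq !nth_nseq binE.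
case: ltnP => h1.
  by rewrite (nth_map 0) ?size_diffs ?sl // nth_diffs // sl; lia.
by case: ltnP => h2; case: ltnP => h3; rewrite ?if_same //; lia.
Qed.

Definition KG_of n (s : seq nat) : nat :=
  KG n ([seq ((nth 0%N s k)%:Z - (if (k < 'C(n, 2))%N then 1 else 0))%R | k <- iota 0 (rr n)] ++ [:: 0%R]).

Lemma KG_of_flowcount n c e : 2 <= n -> size c = n.-1 -> size e = 'C(n.-1, 2) ->
  KG_of n (c ++ e ++ nseq (2 * n - 2) 0) = flowcount n.-1 c e.
Proof.
move=> n2 sc se; rewrite -KG_flowcount // /KG_of; congr KG.
rewrite -[(2 * n - 2).+1]addn1 nseqD [RHS]catA; congr (_ ++ _).
have binE := bin2_pred n2.
apply: (@eq_from_nth _ 0%R).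
  by rewrite size_map size_iota rrE // !size_cat size_map size_cat size_nseq sc se addnA.
move=> k; rewrite size_map size_iota => kr.
rewrite (nth_map 0) ?size_iota // nth_iota // add0n catA nth_cat [RHS]nth_cat.
rewrite size_map size_cat sc se -binE !nth_nseq.
case: ltnP => h1; last by rewrite !if_same subr0.
by rewrite (nth_map 0) // size_cat sc se -binE.
Qed.

Lemma latt_K_sum_gtcount n lam : 2 <= n -> size lam = n ->
  latt_K_sum n lam = gtcount n.-1 (diffs lam).
Proof.
move=> n2 sl; have sd : size (diffs lam) = n.-1 by rewrite size_diffs sl.
pose F s := if sumn s == 'C(n, 2) then KG_of n s else 0.
transitivity (binsum (latt_caps n lam) F).
  rewrite (@binsum_box 'C(n, 2)); last first.
    move=> s _; rewrite /F; case: (eqVneq (sumn s) 'C(n, 2)) => // <- _; exact: leq_all_sumn.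
  rewrite size_mkseq -(@sum_ffun_box nat) /latt_K_sum big_mkcond /=.
  apply: eq_bigr => j _; rewrite /F sumn_ffun_seq.
  case: ifP => _; last by rewrite muln0.
  congr (_ * _).
    by apply: eq_bigr => k _; rewrite nth_ffun_seq nth_mkseq.
  rewrite /KG_of -val_enum_ord -map_comp; congr (KG n (_ ++ _)).
  by apply: eq_map => k /=; rewrite nth_ffun_seq.
(* The capacities form three blocks: the first row, the inner vertices and the side vertices.
   Capacity 0 forces the last block of indices to vanish, and conservation makes the condition on
   the total automatic. *)
rewrite latt_capsE // binsum_cat gtcount_binsum //; apply: eq_binsum => c.
rewrite size_map sd => sc; rewrite binsum_cat; apply: eq_binsum => e.
rewrite size_nseq => se; rewrite binsum_nseq0 /F KG_of_flowcount //.
rewrite !sumn_cat sumn_nseq mul0n addn0; case: eqP => // h.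
apply/esym/eqP; apply: contraT => /(flowcount_neq0 sc se).
by have -> : (n.-1).+1 = n by lia.
Qed.

Local Open Scope ring_scope.

Lemma lamd_diffs n lam k : size lam = n -> sorted geq lam -> (k < n.-1)%N ->
  lamd lam k = (nth 0%N (diffs lam) k)%:R.
Proof.
move=> sl sorl kn; rewrite nth_diffs ?sl; last by lia.
rewrite natrB //; apply: sorted_geq_nth => //; by rewrite sl; lia.
Qed.

Definition vol_sum n (lam : seq nat) : rat :=
  \sum_(s <- box 'C(n, 2) n.-1)
    (\prod_(k < n.-1) (lamd lam k ^+ nth 0%N s k / ((nth 0%N s k)`!)%:R)) *
    (flowcount n.-1 s (nseq 'C(n.-1, 2) 0))%:R.

Lemma vol_N_sumE n lam : (2 <= n)%N -> vol_N_sum n lam = vol_sum n lam.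
Proof.
move=> n2; rewrite /vol_sum -sum_ffun_box; apply: eq_bigr => j _; congr (_ * _).
  by apply: eq_bigr => k _; rewrite nth_ffun_seq.
rewrite -Nsh_flowcount ?size_ffun_seq //.
by have -> : n.-1.+1 = n by lia.
Qed.

Lemma vol_K_sumE n lam : (2 <= n)%N -> vol_K_sum n lam = vol_sum n lam.
Proof.
move=> n2; rewrite /vol_sum -sum_ffun_box /vol_K_sum big_mkcond /=.
apply: eq_bigr => j _; have sj := size_ffun_seq j.
have se : size (nseq 'C(n.-1, 2) 0%N) = 'C(n.-1, 2) by rewrite size_nseq.
case: eqP => h; last first.
  apply/esym/eqP; rewrite mulf_eq0 pnatr_eq0; apply/orP; right.
  apply: contraT => /(flowcount_neq0 sj se).
  by rewrite sumn_nseq mul0n addn0 sumn_ffun_seq (ltn_predK n2) => /h.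
congr (_ * _); first by apply: eq_bigr => k _; rewrite nth_ffun_seq.
congr (_%:R); rewrite -KG_flowcount // map_cat map_nseq; congr KG.
rewrite -[(2 * n - 2).+1]addn1 nseqD -!catA; congr (_ ++ _); first by rewrite /ffun_seq -map_comp.
by congr (nseq _ _ ++ _); rewrite bin2_pred //; lia.
Qed.

(** In the binomial expansion for [t lam], the coefficient product of the term [s] grows at most
    like [t] to the power [sumn s]. Conservation excludes totals above [D], and smaller totals
    disappear in the limit. *)
Lemma tends_to_gtpatterns n lam : (2 <= n)%N -> size lam = n -> sorted geq lam ->
  tends_to (fun t => (gtpatterns n.-1 (map (muln t) lam))%:R / t%:R ^+ 'C(n, 2))
    (vol_sum n lam).
Proof.
move=> n2 sl sorl; pose D := 'C(n, 2).
have nE : n.-1.+1 = n by lia.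
have sorted_t t : sorted geq (map (muln t) lam).
  apply: (homo_sorted (e := geq) (e' := geq)) sorl => x y /=.
  by rewrite leq_mul2l => ->; rewrite orbT.
pose Q c := binsum (nseq 'C(n.-1, 2) 1%N) (flowcount n.-1 c).
have Q0 c : size c = n.-1 -> (D < sumn c)%N -> Q c = 0%N.
  move=> sc cD; rewrite -[RHS](binsum0 (nseq 'C(n.-1, 2) 1%N)); apply: eq_binsum => e.
  rewrite size_nseq => se; apply/eqP; apply: contraT => /(flowcount_neq0 sc se).
  rewrite nE -/D; lia.
have diffs_t t k : (k < n.-1)%N ->
    nth 0%N (diffs (map (muln t) lam)) k = (t * nth 0%N (diffs lam) k)%N.
  move=> kn; rewrite !nth_diffs ?size_map ?sl; try lia.
  by rewrite !(nth_map 0%N) ?sl ?mulnBr //; lia.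
have sdt t : size (diffs (map (muln t) lam)) = n.-1 by rewrite size_diffs size_map sl.
(* Membership in the box is kept in the summand, so that the size of [s] is available when limits
   are taken term by term. *)
apply: (@eq_tends_to (fun t => \sum_(s <- box D n.-1)
   if s \in box D n.-1 then
   (\prod_(i < n.-1) ('C((t * nth 0%N (diffs lam) i).+1, nth 0%N s i))%:R) * (Q s)%:R
      / t%:R ^+ D else 0)).
  move=> t t0; rewrite -gtcount_diffs ?size_map ?sl ?nE // gtcount_binsum //.
  rewrite (@binsum_box D) ?size_map ?sdt; last first.
    move=> s ss Qs; apply: leq_all_sumn; rewrite leqNgt; apply/negP => h.
    by rewrite -/(Q s) Q0 in Qs.
  rewrite natr_sum mulr_suml big_seq [RHS]big_seq; apply: eq_bigr => s sB.
  rewrite sB natrM natr_prod; congr (_ * _ / _); apply: eq_bigr => i _.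
  by rewrite (nth_map 0%N) ?sdt // diffs_t.
rewrite /vol_sum -/D big_seq.
apply: (@eq_tends_to (fun t => \sum_(s <- box D n.-1 | s \in box D n.-1)
   (\prod_(i < n.-1) ('C((t * nth 0%N (diffs lam) i).+1, nth 0%N s i))%:R) * (Q s)%:R
      / t%:R ^+ D)).
  by move=> t _; rewrite big_mkcond.
apply: tends_to_sum => s; rewrite mem_box => /andP[/eqP ss _].
have se : size (nseq 'C(n.-1, 2) 0%N) = 'C(n.-1, 2) by rewrite size_nseq.
have fl0 : sumn s != D -> flowcount n.-1 s (nseq 'C(n.-1, 2) 0) = 0%N.
  move=> h; apply/eqP; apply: contraT => /(flowcount_neq0 ss se).
  by rewrite sumn_nseq mul0n addn0 nE => /eqP; rewrite (negPf h).
have sumE : sumn s = (\sum_(i < n.-1) nth 0 s i)%N.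
  by rewrite sumnE (big_nth 0%N) big_mkord ss.
have base : tends_to (fun t => \prod_(i < n.-1)
      ('C((t * nth 0%N (diffs lam) i).+1, nth 0%N s i))%:R / t%:R ^+ sumn s)
    (\prod_(k < n.-1) (lamd lam k ^+ nth 0%N s k / ((nth 0%N s k)`!)%:R)).
  apply: (@eq_tends_to (fun t => \prod_(i < n.-1)
      (('C((t * nth 0%N (diffs lam) i).+1, nth 0%N s i))%:R / t%:R ^+ nth 0%N s i))).
    by move=> t _; rewrite prodf_div sumE prodrXr.
  apply: tends_to_prod => i _; rewrite (lamd_diffs sl sorl) //; exact: tends_to_bin.
have [sD|sD|sD] := ltngtP (sumn s) D.
- rewrite fl0 ?neq_ltn ?sD // mulr0.
  have inv0 k : (0 < k)%N -> tends_to (fun t => (t%:R ^+ k)^-1) 0.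
    case: k => // k _; elim: k => [|k IHk].
      by apply: eq_tends_to tends_to_inv => t _; rewrite expr1.
    have := tends_toM tends_to_inv IHk; rewrite mul0r; apply: eq_tends_to => t _.
    by rewrite [in RHS]exprS invfM.
  have := tends_toM (tends_toM base (tends_to_cst (Q s)%:R))
    (inv0 (D - sumn s)%N (ltac:(by rewrite subn_gt0))).
  rewrite mulr0; apply: eq_tends_to => t t0.
  rewrite -[in RHS](subnKC (ltnW sD)) exprD invfM; ring.
- rewrite fl0 ?neq_ltn ?sD ?orbT // mulr0 Q0 //.
  by apply: eq_tends_to (tends_to_cst 0) => t _; rewrite mulr0 mul0r.
(* When the first row already has total weight [D], conservation forces all inner weights to be 0,
   so one term of [Q s] remains. *)
have -> : flowcount n.-1 s (nseq 'C(n.-1, 2) 0) = Q s.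
  rewrite /Q binsum_nseq1 // => e se' e0; apply/eqP; apply: contraT.
  by move/(flowcount_neq0 ss se'); rewrite nE -/D sD; lia.
apply: eq_tends_to (tends_toM base (tends_to_cst (Q s)%:R)) => t _.
by rewrite sD mulrAC.
Qed.

(** Both sides are the limit of the same normalised pattern count, evaluated once by the product
    formula and once by the binomial expansion. *)
Lemma vol_prod_sum n lam : (2 <= n)%N -> size lam = n -> sorted geq lam ->
  vol_prod n lam = vol_sum n lam.
Proof.
move=> n2 sl sorl; apply: tends_to_unique (tends_to_latt_prod sl) _.
apply: eq_tends_to (tends_to_gtpatterns n2 sl sorl) => t t0.
rewrite gtpatterns_latt_prod ?size_map //; first by lia.
apply: (homo_sorted (e := geq) (e' := geq)) sorl => x y /=.
by rewrite leq_mul2l => ->; rewrite orbT.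
Qed.

Theorem theorem1p1 (n : nat) (lam : seq nat) :
  (2 <= n)%N -> size lam = n -> sorted geq lam ->
  [/\ GT_volume_is n lam (vol_prod n lam),
      vol_prod n lam = vol_N_sum n lam,
      vol_prod n lam = vol_K_sum n lam,
      (#|GT_int_points n lam|)%:R = latt_prod n lam
    & latt_prod n lam = (latt_K_sum n lam)%:R].
Proof.
move=> n2 sl sorl; have n0 : (0 < n)%N by lia.
split.
- exact: GT_volume.
- by rewrite vol_N_sumE // vol_prod_sum.
- by rewrite vol_K_sumE // vol_prod_sum.
- by rewrite card_GT_int_points // gtpatterns_latt_prod.
rewrite -gtpatterns_latt_prod // latt_K_sum_gtcount // gtcount_diffs //.
by rewrite prednK.
Qed.
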